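(* Let $\mathcal H$ be a separable infinite-dimensional complex Hilbert space, let $C\in B(\mathcal H)$ be a selfadjoint trace-class operator and let $A\in B(\mathcal H)$ be a compact operator. Then $$\overline{W_{\mathcal O(C)}(A)}=W_{\mathcal O(C\oplus\mathbf 0)}(A\oplus\mathbf 0),$$ where $\mathbf 0$ is the zero operator acting on a separable Hilbert space of dimension at least $\operatorname{rank}C$. In particular, if $P\in B(\mathcal H)$ is a projection of rank at least $\operatorname{rank}C$ for which $PA=AP=0$, then $W_{\mathcal O(C)}(A)$ is closed.
   Context: For a trace-class operator $C$ on a Hilbert space, $\mathcal U(C)=\{UCU^*:U\text{ unitary}\}$, $\mathcal O(C)$ is the closure of $\mathcal U(C)$ in the trace norm, and for a bounded operator $A$ on the same space $W_{\mathcal O(C)}(A)=\{\operatorname{Tr}(XA):X\in\mathcal O(C)\}$. Ranks and dimensions take values in $\{0,1,2,\dots\}\cup\{\infty\}$. Projections are orthogonal projections. The direct sums $C\oplus\mathbf 0$ and $A\oplus\mathbf 0$ act on $\mathcal H\oplus\mathcal H_2$, where $\mathcal H_2$ is the space on which $\mathbf 0$ acts. *)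

(* Defs.v *)
From HB Require Import structures.
From mathcomp Require Import all_boot all_order all_algebra.
From mathcomp Require Import complex.
From mathcomp Require Import all_classical all_reals all_analysis.
From mathcomp Require Import ring.

Set Implicit Arguments.
Unset Strict Implicit.
Unset Printing Implicit Defensive.

Import Order.TTheory GRing.Theory Num.Theory.
Import numFieldNormedType.Exports.

Local Open Scope classical_set_scope.
Local Open Scope ring_scope.
Local Open Scope complex_scope.

(* Complex Hilbert spaces over [R[i]].  Inner products are linear in the first
   variable.  The norm of a [normedModType R[i]] takes its (real) values in
   [R[i]], so no cast is needed in [hdotxx]. *)
HB.mixin Record CompleteNormedModule_isHilbert (R : realType) H
    of CompleteNormedModule R[i] H := {
  hdot : H -> H -> R[i];
  hdotDZl : forall (a : R[i]) (x y z : H),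
    hdot (a *: x + y) z = a * hdot x z + hdot y z;
  hdotC : forall x y : H, hdot y x = (hdot x y)^*%C;
  hdotxx : forall x : H, hdot x x = `|x| ^+ 2
}.

#[short(type="hilbertType")]
HB.structure Definition Hilbert (R : realType) :=
  {H of CompleteNormedModule R[i] H & CompleteNormedModule_isHilbert R H}.

Lemma minkowski2_sqr (F : numDomainType) (a b c d s t : F) :
  0 <= a -> 0 <= b -> 0 <= c -> 0 <= d -> 0 <= s -> 0 <= t ->
  s ^+ 2 = a ^+ 2 + c ^+ 2 -> t ^+ 2 = b ^+ 2 + d ^+ 2 ->
  (a + b) ^+ 2 + (c + d) ^+ 2 <= (s + t) ^+ 2.
Proof.
move=> a0 b0 c0 d0 s0 t0 s2 t2.
have cs : a * b + c * d <= s * t.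
  rewrite -(@ler_pXn2r _ 2)// ?nnegrE ?mulr_ge0 ?addr_ge0 ?mulr_ge0//.
  rewrite -subr_ge0 (_ : _ - _ = (a * d - b * c) ^+ 2); last first.
    have -> : (s * t) ^+ 2 = s ^+ 2 * t ^+ 2 by ring.
    by rewrite s2 t2; ring.
  by rewrite real_exprn_even_ge0// realB// realM// ger0_real.
have -> : (s + t) ^+ 2 = s ^+ 2 + t ^+ 2 + (s * t) *+ 2 by ring.
rewrite s2 t2 -subr_ge0 (_ : _ - _ = (s * t - (a * b + c * d)) *+ 2).
  by rewrite mulrn_wge0// subr_ge0.
by ring.
Qed.

Section SumOfSquares.
Variable F : numClosedFieldType.
Implicit Types a b c d : F.

Lemma addr_sqr_ge0 a b : 0 <= a -> 0 <= b -> 0 <= a ^+ 2 + b ^+ 2.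
Proof. by move=> a0 b0; rewrite addr_ge0// exprn_ge0. Qed.

Lemma minkowski2 a b c d : 0 <= a -> 0 <= b -> 0 <= c -> 0 <= d ->
  sqrtC ((a + b) ^+ 2 + (c + d) ^+ 2)
  <= sqrtC (a ^+ 2 + c ^+ 2) + sqrtC (b ^+ 2 + d ^+ 2).
Proof.
move=> a0 b0 c0 d0.
have st0 : 0 <= sqrtC (a ^+ 2 + c ^+ 2) + sqrtC (b ^+ 2 + d ^+ 2).
  by rewrite addr_ge0// sqrtC_ge0 addr_sqr_ge0.
rewrite -[leRHS]sqrCK// ler_sqrtC ?qualifE/= ?exprn_ge0//; last first.
  by rewrite addr_sqr_ge0 ?addr_ge0.
by apply: minkowski2_sqr => //; rewrite ?sqrtC_ge0 ?addr_sqr_ge0 ?sqrtCK.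
Qed.

Lemma ler_sqrtC_sqr a b c d : 0 <= a -> 0 <= b -> a <= c -> b <= d ->
  sqrtC (a ^+ 2 + b ^+ 2) <= sqrtC (c ^+ 2 + d ^+ 2).
Proof.
move=> a0 b0 ac bd; have c0 := le_trans a0 ac; have d0 := le_trans b0 bd.
rewrite ler_sqrtC ?qualifE/= ?addr_sqr_ge0//.
by rewrite lerD// lerXn2r ?nnegrE.
Qed.

Lemma ler_sqrtC_l a b : 0 <= a -> 0 <= b -> a <= sqrtC (a ^+ 2 + b ^+ 2).
Proof.
move=> a0 b0; rewrite -{1}[a]sqrCK// ler_sqrtC ?qualifE/= ?exprn_ge0//.
  by rewrite lerDl exprn_ge0.
by rewrite addr_sqr_ge0.
Qed.

Lemma ler_sqrtC_D a b : 0 <= a -> 0 <= b -> sqrtC (a ^+ 2 + b ^+ 2) <= a + b.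
Proof.
move=> a0 b0; rewrite -[leRHS]sqrCK ?addr_ge0//.
rewrite ler_sqrtC ?qualifE/= ?exprn_ge0 ?addr_sqr_ge0 ?addr_ge0//.
by rewrite sqrrD lerD2r lerDl mulrn_wge0// mulr_ge0.
Qed.

End SumOfSquares.

(* The product type [H * K] already carries the max norm in the library, hence
   the alias. *)
Definition hsum (R : realType) (H K : hilbertType R) : Type := (H * K)%type.

Section HilbertSum.
Context {R : realType} (H K : hilbertType R).

HB.instance Definition _ := GRing.Lmodule.copy (hsum H K) (H * K)%type.

Definition hsum_norm (x : hsum H K) : R[i] :=
  sqrtC (`|x.1| ^+ 2 + `|x.2| ^+ 2).

Let hsum_normD (x y : hsum H K) : hsum_norm (x + y) <= hsum_norm x + hsum_norm y.
Proof.
rewrite /hsum_norm; apply: le_trans (minkowski2 _ _ _ _) => //.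
by apply: ler_sqrtC_sqr => //; rewrite ler_normD.
Qed.

Let hsum_normZ (l : R[i]) (x : hsum H K) :
  hsum_norm (l *: x) = `|l| * hsum_norm x.
Proof.
by rewrite /hsum_norm /= !normrZ !exprMn -mulrDr rootCMl ?exprn_ge0// sqrCK.
Qed.

Let hsum_norm0 (x : hsum H K) : hsum_norm x = 0 -> x = 0.
Proof.
case: x => a b /eqP; rewrite /hsum_norm sqrtC_eq0/= paddr_eq0 ?exprn_ge0//.
by rewrite !expf_eq0/= !normr_eq0 => /andP[/eqP-> /eqP->].
Qed.

HB.instance Definition _ := Lmodule_isNormed.Build R[i] (hsum H K)
  hsum_normD hsum_normZ hsum_norm0.

Lemma hsum_normE (x : hsum H K) : `|x| = sqrtC (`|x.1| ^+ 2 + `|x.2| ^+ 2).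
Proof. by []. Qed.

Let le1 (x : hsum H K) : `|x.1| <= `|x|.
Proof. by rewrite hsum_normE ler_sqrtC_l. Qed.

Let le2 (x : hsum H K) : `|x.2| <= `|x|.
Proof. by rewrite hsum_normE addrC ler_sqrtC_l. Qed.

Let le12 (x : hsum H K) : `|x| <= `|x.1| + `|x.2|.
Proof. by rewrite hsum_normE ler_sqrtC_D. Qed.

Let hsum_complete (F : set_system (hsum H K)) :
  ProperFilter F -> cauchy F -> cvg F.
Proof.
move=> FF /cauchy_ballP Fc; apply/cvg_ex.
have proj (V : hilbertType R) (f : hsum H K -> V) :
    (forall x y, f (x - y) = f x - f y) -> (forall x, `|f x| <= `|x|) ->
    exists l : V, f @ F --> l.
  move=> fB fle; suff fF : cvg (f @ F) by exists (lim (f @ F)); exact: fF.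
  apply/cauchy_cvgP/cauchy_ballP => e e0.
  have Fe := Fc e e0; near_simpl.
  apply: filterS Fe => -[x y]; rewrite -!ball_normE /= => xy.
  by rewrite -fB; exact: le_lt_trans (fle _) xy.
have [l1 F1] := proj H fst (fun _ _ => erefl) le1.
have [l2 F2] := proj K snd (fun _ _ => erefl) le2.
exists (l1, l2) => /=; apply/cvgrPdist_lt => e e0.
have e2 : 0 < e / 2 by rewrite divr_gt0.
move/cvgrPdist_lt : F1 => /(_ _ e2) F1.
move/cvgrPdist_lt : F2 => /(_ _ e2) F2.
near=> x; apply: le_lt_trans (le12 _) _ => /=.
rewrite [ltRHS](splitr e) ltrD//.
  by near: x; exact: F1.
by near: x; exact: F2.
Unshelve. all: by end_near. Qed.

HB.instance Definition _ := Uniform_isComplete.Build (hsum H K) hsum_complete.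

Definition hsum_dot (x y : hsum H K) : R[i] := hdot x.1 y.1 + hdot x.2 y.2.

Let hsum_dotDZl (a : R[i]) (x y z : hsum H K) :
  hsum_dot (a *: x + y) z = a * hsum_dot x z + hsum_dot y z.
Proof. by rewrite /hsum_dot /= !hdotDZl mulrDr addrACA. Qed.

Let hsum_dotC (x y : hsum H K) : hsum_dot y x = (hsum_dot x y)^*%C.
Proof. by rewrite /hsum_dot rmorphD/= -!hdotC. Qed.

Let hsum_dotxx (x : hsum H K) : hsum_dot x x = `|x| ^+ 2.
Proof. by rewrite hsum_normE sqrtCK /hsum_dot !hdotxx. Qed.

HB.instance Definition _ := CompleteNormedModule_isHilbert.Build R (hsum H K)
  hsum_dotDZl hsum_dotC hsum_dotxx.

End HilbertSum.

Section OperatorSum.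
Context {R : realType} (H K : hilbertType R).
Variables (S : {linear H -> H}) (T : {linear K -> K}).

Definition opsum (x : hsum H K) : hsum H K := (S x.1, T x.2).

Let opsum_linear : linear opsum.
Proof. by move=> a x y; rewrite /opsum/= !linearP. Qed.

HB.instance Definition _ :=
  GRing.isLinear.Build R[i] (hsum H K) (hsum H K) _ opsum opsum_linear.

End OperatorSum.

Section Spaces.
Context {R : realType} {H : hilbertType R}.

Definition separable := exists D : set H, countable D /\ dense D.

Definition lin_indep (n : nat) (v : 'I_n -> H) :=
  forall a : 'I_n -> R[i], \sum_i a i *: v i = 0 -> forall i, a i = 0.

(* Dimension with values in [{0, 1, 2, ...} U {+oo}]; all infinite dimensions
   are [+oo]. *)
Definition hdim (V : set H) : \bar R :=
  ereal_sup [set n%:R%:E | n in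
    [set n | exists v : 'I_n -> H, (forall i, V (v i)) /\ lin_indep v]].

(* A separable Hilbert space has a finite or countable orthonormal basis, here
   a sequence indexed by all of [nat] in which some terms may be zero, so that
   finite-dimensional spaces are covered as well. *)
Definition orthonormal_basis (e : nat -> H) :=
  [/\ forall m n, m != n -> hdot (e m) (e n) = 0,
      forall n, e n = 0 \/ `|e n| = 1
    & forall x, (forall n, hdot x (e n) = 0) -> x = 0].

(* [xget] selects one such basis; it exists whenever [H] is separable. *)
Definition onb : nat -> H := xget (fun=> 0) orthonormal_basis.

End Spaces.
Arguments separable {R} H.

Section Operators.
Context {R : realType} {H : hilbertType R}.
Implicit Types A C P T U X : {linear H -> H}.

(* The elements of [B(H)] are the [T : {linear H -> H}] with [continuous T]. *)

(* In [adjoint] and [opabs], the default [\0] of [xget] is not reached when [T]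
   is continuous: the selected operator exists and is unique (Riesz
   representation, square root of a positive operator). *)
Definition adjoint T : {linear H -> H} :=
  xget (\0 : {linear H -> H})
    [set S : {linear H -> H} | continuous S /\
      forall x y, hdot (T x) y = hdot x (S y)].

Definition selfadjoint T := forall x y, hdot (T x) y = hdot x (T y).

Definition projection P := [/\ continuous P, selfadjoint P & P \o P =1 P].

Definition unitary U :=
  [/\ continuous U, adjoint U \o U =1 id & U \o adjoint U =1 id].

(* For scalars in [R[i]], [0 <= z] says that [z] is real and nonnegative. *)
Definition positive T := forall x, 0 <= hdot (T x) x.

(* |T| = (T^* T)^(1/2) *)
Definition opabs T : {linear H -> H} :=
  xget (\0 : {linear H -> H})
    [set P : {linear H -> H} | [/\ continuous P, positive P &
      P \o P =1 adjoint T \o T]].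

Definition rank T : \bar R := hdim (range T).

(* [precompact B] means that the closure of [B] is compact. *)
Definition compact_op T := precompact (T @` [set x | `|x| <= 1]).

(* Tr |T|; neither this sum nor, for a trace-class [T], the value of [trace T]
   depends on the orthonormal basis. *)
Definition trace_norm T : \bar R :=
  (\sum_(0 <= n <oo) (complex.Re (hdot (opabs T (onb n)) (onb n)))%:E)%E.

Definition trace_class T := continuous T /\ (trace_norm T < +oo)%E.

(* [R[i]^o] is [R[i]] with its norm topology. *)
Definition trace T : R[i]^o :=
  lim (series (fun n => hdot (T (onb n)) (onb n) : R[i]^o) @ \oo).

(* U(C), O(C) and W_{O(C)}(A) *)
Definition unitary_orbit C : set {linear H -> H} :=
  [set (U \o C \o adjoint U : {linear H -> H}) | U in unitary].

Definition orbit_closure C : set {linear H -> H} :=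
  [set X : {linear H -> H} | trace_class X /\
    forall eps : R, 0 < eps -> exists2 Y : {linear H -> H},
      unitary_orbit C Y & (trace_norm (X \- Y)%R < eps%:E)%E].

Definition orbit_range C A : set R[i]^o :=
  [set trace (X \o A) | X in orbit_closure C].

End Operators.

(* Main.v *)
Require Import Defs.
From HB Require Import structures.
From mathcomp Require Import all_boot all_order all_algebra.
From mathcomp Require Import complex.
From mathcomp Require Import all_classical all_reals all_analysis.
From mathcomp Require Import ring lra.

(** Write [C = \sum_n c n <., e n> e n] with orthonormal eigenvectors [e n] for
    the nonzero eigenvalues [c n].  The elements of the closed orbit of [C] are
    approximated in trace norm by the operators [U C U^*], whose trace against
    [A] is [\sum_n c n <A U (e n), U (e n)>].  The proof compares all the ranges
    in the statement with one auxiliary set, [contractive_values A c]: the sums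
    [\sum_n c n <A (f n), f n>] where [f] is only required to be contractive,
    that is, to have a Gram matrix at most the identity.

    This set is closed ([contractive_values_closed]).  Along a free ultrafilter a
    sequence of contractive families has a termwise weak limit, which is again
    contractive; [A], being compact, sends the weak convergence to norm
    convergence, and the series are dominated by a multiple of [\sum_n `|c n|].
    Since unitary images of [e] are contractive, and so are the first components
    of orthonormal families of a direct sum, both the range of [C] and that of
    [C (+) 0] lie in this closed set ([orbit_range_closure_values]).

    Conversely, a contractive family [f] dilates: there are vectors [g n], in any
    space of dimension at least the rank of [C], with
    [<g m, g n> = delta m n - <f m, f n>] ([dilation]).  Then [h n = f n + g n] is
    orthonormal, and [\sum_n c n <., h n> h n] belongs to the closed orbit, because
    finitely many [e n] can be moved to the [h n] by a unitary operator and the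
    tail of [c] is small ([orbit_closure_diagonal]).  With the [g n] in the second
    summand, the value of [f] is in the range of [C (+) 0].  With the [g n] in the
    range of [P] and [f] replaced by [(1 - P) f], it is in the range of [C], which
    is therefore closed.  Finally, with the [g n] in [H] itself but orthogonal to
    more and more basis vectors, [h] tends weakly to [f], so that the value of [f]
    is in the closure of the range of [C] ([values_sub_closure]).

    The underlying operator theory is built from orthonormal bases: Riesz
    representation, the square root of [T^* T] by a quadratic recursion
    ([abs_exists]), the spectral theorem for selfadjoint Hilbert-Schmidt
    operators ([hilbert_schmidt_eigensystem]), and two facts on the trace norm: a
    trace class operator has a Schmidt decomposition whose coefficients have sum
    at most its trace norm ([schmidt_decomposition]), and a bound for all sums
    [\sum_m <T (e m), w m>] over contractive families bounds the trace norm
    ([nuclear_trace_norm]). *)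

Set Implicit Arguments.
Unset Strict Implicit.
Unset Printing Implicit Defensive.

Import Order.TTheory GRing.Theory Num.Theory.
Import numFieldNormedType.Exports.

Local Open Scope classical_set_scope.
Local Open Scope ring_scope.
Local Open Scope complex_scope.

(** * Real-valued norms and scalar products *)

Section RealNorm.
Context {R : realType}.

(** Norms take their values in [R[i]]; the real field [R], which is totally
    ordered, is the convenient place for estimates. *)
Definition rn (V : normedZmodType R[i]) (x : V) : R := complex.Re `|x|.
Arguments rn {V} x.

Section Zmod.
Variable V : normedZmodType R[i].
Implicit Types x y : V.

Lemma rnE x : `|x| = (rn x)%:C.
Proof. by rewrite /rn RRe_real// normr_real. Qed.

Lemma rn_ge0 x : 0 <= rn x.
Proof. by rewrite -ler0c -rnE. Qed.

Lemma rn0 : rn (0 : V) = 0.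
Proof. by rewrite /rn normr0. Qed.

Lemma rn0_eq0 x : rn x = 0 -> x = 0.
Proof. by move=> x0; apply/eqP; rewrite -normr_eq0 rnE x0. Qed.

Lemma rnN x : rn (- x) = rn x.
Proof. by rewrite /rn normrN. Qed.

Lemma rnB x y : rn (x - y) = rn (y - x).
Proof. by rewrite -rnN opprB. Qed.

Lemma rnD x y : rn (x + y) <= rn x + rn y.
Proof. by rewrite -lecR rmorphD/= -!rnE ler_normD. Qed.

Lemma rn_subl x y : rn x <= rn y + rn (x - y).
Proof. by rewrite -[X in rn X <= _](subrK y) addrC rnD. Qed.

Lemma rn_sum I (r : seq I) (P : pred I) (F : I -> V) :
  rn (\sum_(i <- r | P i) F i) <= \sum_(i <- r | P i) rn (F i).
Proof.
elim/big_rec2 : _ => [|i y x _ xy]; first by rewrite rn0.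
by rewrite (le_trans (rnD _ _))// lerD2l.
Qed.

End Zmod.

Lemma rnc z : rn (z : R[i]) = Num.sqrt (complex.Re z ^+ 2 + complex.Im z ^+ 2).
Proof. by rewrite /rn normc_def. Qed.

Lemma rnM (a b : R[i]) : rn (a * b) = rn a * rn b.
Proof. by apply: complexI; rewrite rmorphM/= -!rnE normrM. Qed.

Lemma rnJ (a : R[i]) : rn (a^*%C) = rn a.
Proof. by rewrite /rn normcJ. Qed.

Lemma rn1 : rn (1 : R[i]) = 1.
Proof. by rewrite /rn normr1. Qed.

Lemma rn_real (a : R) : rn a%:C = `|a|.
Proof. by rewrite rnc/= expr0n addr0 sqrtr_sqr. Qed.

Lemma mulcJ (a : R[i]) : a * a^*%C = (rn a ^+ 2)%:C.
Proof. by rewrite -sqr_normc rnE rmorphXn. Qed.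

Lemma conjcM (a b : R[i]) : (a * b)^*%C = a^*%C * b^*%C.
Proof. exact: rmorphM. Qed.

Lemma conjcD (a b : R[i]) : (a + b)^*%C = a^*%C + b^*%C.
Proof. exact: rmorphD. Qed.

Lemma conjcN (a : R[i]) : (- a)^*%C = - a^*%C.
Proof. exact: rmorphN. Qed.

Lemma realcM (a b : R) : (a * b)%:C = a%:C * b%:C :> R[i].
Proof. exact: rmorphM. Qed.

Lemma realcD (a b : R) : (a + b)%:C = a%:C + b%:C :> R[i].
Proof. exact: rmorphD. Qed.

Lemma realcN (a : R) : (- a)%:C = - a%:C :> R[i].
Proof. exact: rmorphN. Qed.

Lemma cReD (a b : R[i]) : complex.Re (a + b) = complex.Re a + complex.Re b.
Proof. by case: a b => [? ?] []. Qed.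

Lemma cReN (a : R[i]) : complex.Re (- a) = - complex.Re a.
Proof. by case: a. Qed.

Lemma cReJ (a : R[i]) : complex.Re a^*%C = complex.Re a.
Proof. by case: a. Qed.

Lemma cReMl (r : R) (a : R[i]) : complex.Re (r%:C * a) = r * complex.Re a.
Proof. by case: a => [? ?] /=; rewrite mul0r subr0. Qed.

Lemma cRe_sum I (r : seq I) (P : pred I) (F : I -> R[i]) :
  complex.Re (\sum_(i <- r | P i) F i) = \sum_(i <- r | P i) complex.Re (F i).
Proof. by apply: (big_morph _ cReD). Qed.

Lemma normRe (a : R[i]) : `|complex.Re a| <= rn a.
Proof. by rewrite -lecR -rnE normc_ge_Re. Qed.

Lemma leRe (a : R[i]) : complex.Re a <= rn a.
Proof. exact: le_trans (ler_norm _) (normRe a). Qed.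

Lemma normIm (a : R[i]) : `|complex.Im a| <= rn a.
Proof. by rewrite rnc -sqrtr_sqr ler_wsqrtr// lerDr sqr_ge0. Qed.

Lemma rn_le_ReIm (a : R[i]) : rn a <= `|complex.Re a| + `|complex.Im a|.
Proof.
rewrite rnc -[leRHS]ger0_norm ?addr_ge0// -sqrtr_sqr ler_wsqrtr// sqrrD.
by rewrite !real_normK ?num_real// addrAC lerDl mulrn_wge0// mulr_ge0.
Qed.

Lemma ge0_ReC (a : R[i]) : 0 <= a -> a = (complex.Re a)%:C.
Proof. by move=> a0; rewrite RRe_real// ger0_real. Qed.

Lemma rnZ (V : normedModType R[i]) (a : R[i]) (x : V) : rn (a *: x) = rn a * rn x.
Proof. by apply: complexI; rewrite rmorphM/= -!rnE normrZ. Qed.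

End RealNorm.
Arguments rn {R V} x.

Section HilbertBasics.
Context {R : realType} {H : hilbertType R}.
Implicit Types (x y z : H) (a : R[i]).

Lemma hdotDl x y z : hdot (x + y) z = hdot x z + hdot y z.
Proof. by rewrite -[x in LHS]scale1r hdotDZl mul1r. Qed.

Lemma hdot0l z : hdot 0 z = 0.
Proof. by apply: (addrI (hdot 0 z)); rewrite -hdotDl !addr0. Qed.

Lemma hdotZl a x z : hdot (a *: x) z = a * hdot x z.
Proof. by rewrite -[a *: x]addr0 hdotDZl hdot0l addr0. Qed.

Lemma hdotNl x z : hdot (- x) z = - hdot x z.
Proof. by rewrite -scaleN1r hdotZl mulN1r. Qed.

Lemma hdotBl x y z : hdot (x - y) z = hdot x z - hdot y z.
Proof. by rewrite hdotDl hdotNl. Qed.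

Lemma hdotDr x y z : hdot x (y + z) = hdot x y + hdot x z.
Proof. by rewrite hdotC hdotDl rmorphD/= -!hdotC. Qed.

Lemma hdot0r z : hdot z 0 = 0.
Proof. by rewrite hdotC hdot0l rmorph0. Qed.

Lemma hdotZr a x z : hdot x (a *: z) = a^*%C * hdot x z.
Proof. by rewrite hdotC hdotZl rmorphM/= -hdotC. Qed.

Lemma hdotNr x z : hdot x (- z) = - hdot x z.
Proof. by rewrite hdotC hdotNl rmorphN/= -hdotC. Qed.

Lemma hdotBr x y z : hdot x (y - z) = hdot x y - hdot x z.
Proof. by rewrite hdotDr hdotNr. Qed.

Lemma hdot_suml I (r : seq I) (P : pred I) (F : I -> H) z :
  hdot (\sum_(i <- r | P i) F i) z = \sum_(i <- r | P i) hdot (F i) z.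
Proof. by apply: (big_morph (hdot^~ z)) => [x y|]; rewrite ?hdotDl ?hdot0l. Qed.

Lemma hdot_sumr I (r : seq I) (P : pred I) (F : I -> H) z :
  hdot z (\sum_(i <- r | P i) F i) = \sum_(i <- r | P i) hdot z (F i).
Proof. by apply: (big_morph (hdot z)) => [x y|]; rewrite ?hdotDr ?hdot0r. Qed.

Lemma hdotE x : hdot x x = (rn x ^+ 2)%:C.
Proof. by rewrite hdotxx rnE rmorphXn. Qed.

Lemma Re_hdot x : complex.Re (hdot x x) = rn x ^+ 2.
Proof. by rewrite hdotE. Qed.

Lemma hdot_eq0 x : hdot x x = 0 -> x = 0.
Proof.
by rewrite hdotE => /(congr1 (@complex.Re R))/= /eqP; rewrite sqrf_eq0 => /eqP/rn0_eq0.
Qed.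

Lemma hdot_ext x y : (forall z, hdot x z = hdot y z) -> x = y.
Proof.
move=> xy; apply/eqP; rewrite -subr_eq0; apply/eqP/hdot_eq0.
by rewrite hdotBl xy subrr.
Qed.

Lemma rnDsqr x y :
  rn (x + y) ^+ 2 = rn x ^+ 2 + 2 * complex.Re (hdot x y) + rn y ^+ 2.
Proof.
rewrite -!Re_hdot hdotDl !hdotDr !cReD (hdotC x y) cReJ; lra.
Qed.

Lemma rnBsqr x y :
  rn (x - y) ^+ 2 = rn x ^+ 2 - 2 * complex.Re (hdot x y) + rn y ^+ 2.
Proof. by rewrite rnDsqr hdotNr cReN rnN mulrN. Qed.

Lemma pythagoras x y : hdot x y = 0 -> rn (x + y) ^+ 2 = rn x ^+ 2 + rn y ^+ 2.
Proof. by move=> xy; rewrite rnDsqr xy mulr0 addr0. Qed.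

Lemma cauchy_schwarz x y : rn (hdot x y) <= rn x * rn y.
Proof.
have [/rn0_eq0 ->|y0] := eqVneq (rn y) 0; first by rewrite hdot0r !rn0 mulr0.
have y_gt0 : 0 < rn y by rewrite lt_neqAle eq_sym y0 rn_ge0.
(* [s *: y] is the projection of [x] on [y] *)
set t := hdot x y; pose s := ((rn y ^+ 2)^-1)%:C * t.
have := sqr_ge0 (rn (x - s *: y)); rewrite rnBsqr hdotZr rnZ.
have -> : s^*%C * hdot x y = ((rn y ^+ 2)^-1 * rn t ^+ 2)%:C.
  by rewrite /s conjcM conjc_real -mulrA [t^*%C * _]mulrC mulcJ -realcM.
rewrite /= /s rnM rn_real ger0_norm ?invr_ge0 ?sqr_ge0//.
have -> : (((rn y ^+ 2)^-1 * rn t) * rn y) ^+ 2 = (rn y ^+ 2)^-1 * rn t ^+ 2.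
  by field.
move=> h; have : (rn y ^+ 2)^-1 * rn t ^+ 2 <= rn x ^+ 2 by lra.
rewrite mulrC ler_pdivrMr ?exprn_gt0// -exprMn.
by rewrite ler_pXn2r// nnegrE ?mulr_ge0 ?rn_ge0.
Qed.

End HilbertBasics.

Section Bounded.
Context {R : realType}.
Implicit Types H K : hilbertType R.

Lemma continuous_boundedP H (T : {linear H -> H}) :
  continuous T <-> exists2 M : R, 0 <= M & forall x, rn (T x) <= M * rn x.
Proof.
rewrite -linear_bounded_continuous; split.
  move=> /linear_boundedP [M [Mr MT]].
  have [m Mm] := complex_realP _ Mr.
  exists (`|m| + 1); first by rewrite addr_ge0.
  move=> x; have := MT (`|m| + 1)%:C.
  rewrite Mm ltcR => /(_ (ltr_pwDr ltr01 (ler_norm _)) x).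
  by rewrite !rnE -rmorphM lecR.
move=> [M M0 MT]; apply/linear_boundedP; exists M%:C; split.
  by apply/complex_realP; exists M.
move=> r Mr x; rewrite (@le_trans _ _ (M%:C * `|x|))//.
  by rewrite !rnE -rmorphM lecR.
by rewrite ler_wpM2r// ltW.
Qed.

End Bounded.

(** * Limits, sums and dominated convergence *)

Section RealSums.
Context {R : realType}.

Lemma summable_tail (g : nat -> R) (S : R) :
  (forall n, 0 <= g n) -> (forall N, \sum_(k < N) g k <= S) ->
  forall eps : R, 0 < eps ->
  exists N, forall n, \sum_(N <= k < n) g k < eps.
Proof.
move=> g0 gS eps eps0.
pose E := range (fun N => \sum_(k < N) g k).
have Esup : has_sup E.
  split; first by exists (\sum_(k < 0) g k), 0%N.
  by exists S => _ [N _ <-].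
have [_ [N _ <-] Nsup] := sup_adherent eps0 Esup.
exists N => n; have [nN|Nn] := leqP n N; first by rewrite big_geq.
have : \sum_(k < n) g k <= sup E by apply: ub_le_sup; [exact: Esup.2|exists n].
rewrite -!(big_mkord xpredT g) in Nsup *.
by rewrite (@big_cat_nat _ _ _ N) ?(ltnW Nn)//= => ?; lra.
Qed.

Lemma ler_of_sqr (a b : R) : 0 <= b -> a ^+ 2 <= b ^+ 2 -> a <= b.
Proof.
move=> b0 ab; rewrite (le_trans (ler_norm a))// -(@ler_pXn2r _ 2) ?nnegrE//.
by rewrite real_normK ?num_real.
Qed.

Lemma sum_cauchy_schwarz (x y : nat -> R) N :
  (\sum_(k < N) x k * y k) ^+ 2 <= (\sum_(k < N) x k ^+ 2) * \sum_(k < N) y k ^+ 2.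
Proof.
elim: N => [|N IH]; first by rewrite !big_ord0 expr0n mul0r.
rewrite !big_ord_recr/=.
have A0 : 0 <= \sum_(k < N) x k ^+ 2 by apply: sumr_ge0 => i _; rewrite sqr_ge0.
have B0 : 0 <= \sum_(k < N) y k ^+ 2 by apply: sumr_ge0 => i _; rewrite sqr_ge0.
move: IH A0 B0; set S := \sum_(k < N) _; set A := \sum_(k < N) _.
set B := \sum_(k < N) _; set s := x N; set t := y N => IH A0 B0.
suff : 2 * S * (s * t) <= A * t ^+ 2 + B * s ^+ 2 by nra.
apply: ler_of_sqr; first by rewrite addr_ge0// mulr_ge0// sqr_ge0.
rewrite -subr_ge0.
have -> : (A * t ^+ 2 + B * s ^+ 2) ^+ 2 - (2 * S * (s * t)) ^+ 2 =
  (A * t ^+ 2 - B * s ^+ 2) ^+ 2 + 4 * (s * t) ^+ 2 * (A * B - S ^+ 2) by ring.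
have : 0 <= A * B - S ^+ 2 by rewrite subr_ge0.
move=> AB; apply: addr_ge0; first exact: sqr_ge0.
by apply: mulr_ge0 => //; apply: mulr_ge0 => //; exact: sqr_ge0.
Qed.

Lemma sum_cauchy_schwarz_le (x y : nat -> R) (X Y : R) N :
  0 <= X -> 0 <= Y ->
  \sum_(k < N) x k ^+ 2 <= X ^+ 2 -> \sum_(k < N) y k ^+ 2 <= Y ^+ 2 ->
  \sum_(k < N) x k * y k <= X * Y.
Proof.
move=> X0 Y0 xX yY; apply: ler_of_sqr; first exact: mulr_ge0.
rewrite (le_trans (sum_cauchy_schwarz _ _ _))// exprMn ler_pM//.
  by apply: sumr_ge0 => i _; rewrite sqr_ge0.
by apply: sumr_ge0 => i _; rewrite sqr_ge0.
Qed.

End RealSums.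

Section Limits.
Context {R : realType}.

Lemma cvg_rnP (V : normedModType R[i]) T (F : set_system T) {FF : Filter F}
    (f : T -> V) (l : V) :
  f @ F --> l <-> forall eps : R, 0 < eps -> \forall t \near F, rn (f t - l) < eps.
Proof.
split=> [/cvgrPdist_lt fl eps eps0|fl].
  have /fl : (0 : R[i]) < eps%:C by rewrite ltcR.
  by apply: filterS => t; rewrite rnE ltcR -rnN opprB.
apply/cvgrPdist_lt => eps eps0.
have epsE := ge0_ReC (ltW eps0).
have /fl : 0 < complex.Re eps by rewrite -ltcR -epsE.
by apply: filterS => t; rewrite rnE epsE ltcR -rnN opprB.
Qed.

Lemma cvg_rn_le (V : normedModType R[i]) T (F : set_system T) {FF : ProperFilter F}
    (f : T -> V) (l x : V) (M : R) :
  f @ F --> l -> (\forall t \near F, rn (f t - x) <= M) -> rn (l - x) <= M.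
Proof.
move=> /cvg_rnP fl fM; apply/ler_addgt0Pr => e e0.
have [t [tl tM]] := filter_ex (filterI (fl _ e0) fM).
rewrite (le_trans _ (lerD tM (ltW tl)))//.
by rewrite -[l - x](subrKA (f t)) (le_trans (rnD _ _))// [rn (l - _)]rnB addrC.
Qed.

Lemma limn_unique (V : normedModType R[i]) T (F : set_system T) {FF : ProperFilter F}
    (f : T -> V) (l m : V) : f @ F --> l -> f @ F --> m -> l = m.
Proof.
move=> fl /cvg_rnP fm; apply/eqP; rewrite -subr_eq0; apply/eqP/rn0_eq0/eqP.
rewrite eq_le rn_ge0 andbT; apply/ler_addgt0Pr => e e0; rewrite add0r.
by apply: (cvg_rn_le fl); apply: filterS (fm _ e0) => t /ltW.
Qed.

(** Real tolerances avoid the partial order of [R[i]]. *)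
Lemma cauchy_series_cvg (V : completeNormedModType R[i]) (u : nat -> V) :
  (forall eps : R, 0 < eps -> exists N, forall m n, (N <= m)%N ->
     rn (\sum_(m <= k < n) u k) < eps) ->
  exists x : V, (fun N => \sum_(n < N) u n) @ \oo --> x.
Proof.
move=> uN; have vc : cvg (series u @ \oo).
  apply/cauchy_cvgP/cauchy_seriesP => e e0.
  have epsE := ge0_ReC (ltW e0).
  have [|N NP] := uN (complex.Re e); first by rewrite -ltcR -epsE.
  exists ([set n | N <= n]%N, [set n | N <= n]%N) => /=; first by split; exists N.
  by move=> [m n] /= [Nm _]; rewrite rnE epsE ltcR NP.
exists (lim (series u @ \oo)).
by under eq_fun do rewrite -(big_mkord xpredT u); exact: vc.
Qed.

Lemma abs_series_cvg (V : completeNormedModType R[i]) (u : nat -> V) (g : nat -> R) S :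
  (forall n, rn (u n) <= g n) -> (forall N, \sum_(k < N) g k <= S) ->
  exists x : V, (fun N => \sum_(n < N) u n) @ \oo --> x.
Proof.
move=> ug gS.
have g0 n : 0 <= g n by apply: le_trans (ug n); exact: rn_ge0.
apply: cauchy_series_cvg => e e0; have [N NP] := summable_tail g0 gS e0.
exists N => m n Nm; rewrite (le_lt_trans (rn_sum _ _ _))//.
have [mn|nm] := leqP m n; last by rewrite big_geq// ltnW.
rewrite (le_lt_trans _ (NP n))// (@big_cat_nat _ _ _ m N)//=.
rewrite (le_trans (_ : _ <= \sum_(m <= k < n) g k)) ?ler_sum//.
by rewrite lerDr sumr_ge0.
Qed.

Definition has_sum (u : nat -> R[i]) (s : R[i]) :=
  (fun n => \sum_(k < n) u k : R[i]^o) @ \oo --> (s : R[i]^o).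

Lemma has_sumP u s : has_sum u s <->
  forall eps : R, 0 < eps ->
    exists N, forall n, (N <= n)%N -> rn (\sum_(k < n) u k - s) < eps.
Proof.
split=> [/cvg_rnP us eps /us [N _ NP]|us]; first by exists N.
by apply/cvg_rnP => eps /us [N NP]; exists N.
Qed.

Lemma has_sum_ext u v s : (forall n, u n = v n) -> has_sum u s -> has_sum v s.
Proof. by move=> uv; rewrite (_ : u = v)//; apply/funext. Qed.

Lemma has_sum_unique u s t : has_sum u s -> has_sum u t -> s = t.
Proof. exact: limn_unique. Qed.

Lemma has_sumD u v s t :
  has_sum u s -> has_sum v t -> has_sum (fun n => u n + v n) (s + t).
Proof.
move=> us vt; rewrite /has_sum.
under eq_fun do rewrite big_split/=.
exact: (@cvgD _ R[i]^o _ _ _ _ _ _ _ us vt).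
Qed.

Lemma has_sumZ u s a : has_sum u s -> has_sum (fun n => a * u n) (a * s).
Proof.
move=> us; rewrite /has_sum; under eq_fun do rewrite -mulr_sumr.
exact: (@cvgZl_tmp _ R[i]^o _ _ _ a _ _ us).
Qed.

Lemma has_sumB u v s t :
  has_sum u s -> has_sum v t -> has_sum (fun n => u n - v n) (s - t).
Proof.
move=> us /(has_sumZ (a := -1)) vt; rewrite -mulN1r.
by apply: has_sum_ext (has_sumD us vt) => n; rewrite mulN1r.
Qed.

Lemma has_sum0 : has_sum (fun=> 0) 0.
Proof. by apply/has_sumP => e e0; exists 0%N => n _; rewrite big1// subrr rn0. Qed.

Lemma has_sum_sum M (u : nat -> nat -> R[i]) (s : nat -> R[i]) :
  (forall m, has_sum (u m) (s m)) ->
  has_sum (fun n => \sum_(m < M) u m n) (\sum_(m < M) s m).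
Proof.
move=> us; elim: M => [|M IH].
  by rewrite big_ord0; apply: has_sum_ext has_sum0 => n; rewrite big_ord0.
rewrite big_ord_recr/=.
by apply: has_sum_ext (has_sumD IH (us M)) => n; rewrite big_ord_recr.
Qed.

Lemma has_sum_le u s (g : nat -> R) S :
  (forall n, rn (u n) <= g n) -> (forall N, \sum_(k < N) g k <= S) ->
  has_sum u s -> rn s <= S.
Proof.
move=> ug gS us; rewrite -[s]subr0; apply: (cvg_rn_le us).
near=> n; rewrite subr0 (le_trans (rn_sum _ _ _))//.
by rewrite (le_trans _ (gS n))// ler_sum.
Unshelve. all: by end_near. Qed.

Lemma has_sum_dist u s (g : nat -> R) e N :
  (forall n, rn (u n) <= g n) -> (forall n, \sum_(N <= k < n) g k <= e) ->
  has_sum u s -> rn (s - \sum_(k < N) u k) <= e.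
Proof.
move=> ug ge us; apply: (cvg_rn_le us).
exists N => // n /= Nn.
rewrite -!(big_mkord xpredT u) (@big_cat_nat _ _ _ N)//= addrAC subrr add0r.
rewrite (le_trans (rn_sum _ _ _))//.
by rewrite (le_trans _ (ge n))// ler_sum.
Qed.

(** The real and imaginary parts of an absolutely summable complex sequence are
    dominated, hence Cauchy; completeness of [R] gives the sum. *)
Lemma abs_has_sum u (g : nat -> R) S :
  (forall n, rn (u n) <= g n) -> (forall N, \sum_(k < N) g k <= S) ->
  exists s, has_sum u s.
Proof.
move=> ug gS.
have g0 n : 0 <= g n by apply: le_trans (ug n); exact: rn_ge0.
have real_sum (v : nat -> R) : (forall n, `|v n| <= g n) ->
    exists s : R, (fun n => \sum_(k < n) v k) @ \oo --> s.
  move=> vg; have : cvg (series v @ \oo).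
    apply/cauchy_cvgP/cauchy_seriesP => e e0.
    have [N NP] := summable_tail g0 gS e0.
    exists ([set n | N <= n]%N, [set n | N <= n]%N) => //=.
      by split; exists N.
    move=> [m n] /= [Nm _]; rewrite (le_lt_trans (ler_norm_sum _ _ _))//.
    have [mn|nm] := leqP m n; last by rewrite big_geq// ltnW.
    rewrite (le_lt_trans _ (NP n))// (@big_cat_nat _ _ _ m N)//=.
    rewrite (le_trans (_ : _ <= \sum_(m <= k < n) g k)) ?ler_sum//.
    by rewrite lerDr sumr_ge0.
  move=> vc; exists (lim (series v @ \oo)).
  by under eq_fun do rewrite -(big_mkord xpredT v); exact: vc.
have [r rP] := real_sum (fun n => complex.Re (u n)) (fun n => le_trans (normRe _) (ug n)).
have [t tP] := real_sum (fun n => complex.Im (u n)) (fun n => le_trans (normIm _) (ug n)).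
exists (r +i* t); apply/has_sumP => e e0.
have e2 : 0 < e / 2 by rewrite divr_gt0.
move/cvgrPdist_lt : rP => /(_ _ e2)[N1 _ N1P].
move/cvgrPdist_lt : tP => /(_ _ e2)[N2 _ N2P].
exists (maxn N1 N2) => n; rewrite geq_max => /andP[n1 n2].
rewrite (le_lt_trans (rn_le_ReIm _))// [ltRHS]splitr.
have ImS : complex.Im (\sum_(k < n) u k) = \sum_(k < n) complex.Im (u k).
  by apply: (big_morph (@complex.Im R)) => // -[? ?] [].
apply: ltrD.
  have := N1P n n1; rewrite distrC; congr (`|_| < _).
  by rewrite cReD cReN cRe_sum.
have := N2P n n2; rewrite distrC; congr (`|_| < _).
rewrite -ImS; by case: (\sum_(k < n) u k).
Qed.

(** Dominated convergence for series, along an arbitrary filter: beyond a fixed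
    index the dominating series is small uniformly in the parameter, and below it
    only finitely many terms have to converge. *)
Lemma tannery T (F : set_system T) {FF : Filter F}
    (u : nat -> T -> R[i]) (v : nat -> R[i]) (g : nat -> R) (S : R)
    (s : T -> R[i]) (t : R[i]) :
  (forall n i, rn (u n i) <= g n) -> (forall n, rn (v n) <= g n) ->
  (forall N, \sum_(k < N) g k <= S) ->
  (forall n, (u n : T -> R[i]^o) @ F --> (v n : R[i]^o)) ->
  (forall i, has_sum (u^~ i) (s i)) -> has_sum v t ->
  (s : T -> R[i]^o) @ F --> (t : R[i]^o).
Proof.
move=> ug vg gS uv us vt; apply/cvg_rnP => e e0.
have g0 n : 0 <= g n by apply: le_trans (vg n); exact: rn_ge0.
have e3 : 0 < e / 3 by rewrite divr_gt0.
have [N NP] := summable_tail g0 gS e3.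
have NP' n : \sum_(N <= k < n) g k <= e / 3 by apply: ltW.
have : (fun i => \sum_(k < N) u k i : R[i]^o) @ F --> (\sum_(k < N) v k : R[i]^o).
  elim: N {NP NP'} => [|N IH].
    under eq_fun do rewrite big_ord0.
    by rewrite big_ord0; exact: cvg_cst.
  under eq_fun do rewrite big_ord_recr/=.
  by rewrite big_ord_recr/=; apply: cvgD IH (uv N).
move=> /cvg_rnP/(_ _ e3); apply: filterS => i iN.
have h1 := has_sum_dist (ug^~ i) NP' (us i).
have h2 := has_sum_dist vg NP' vt.
rewrite -(subrKA (\sum_(k < N) u k i)) (le_lt_trans (rnD _ _))//.
rewrite -[X in _ + rn X](subrKA (\sum_(k < N) v k)).
have := rnD (\sum_(k < N) u k i - \sum_(k < N) v k) (\sum_(k < N) v k - t).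
rewrite [rn (_ - t)]rnB => h3.
have {}iN : rn (\sum_(k < N) u k i - \sum_(k < N) v k) < e / 3 by [].
set a := rn (s i - _) in h1 *; set b := rn (t - _) in h2 h3.
set c := rn (_ - \sum_(k < N) v k) in iN h3.
rewrite (le_lt_trans (lerD h1 h3))//; lra.
Qed.

End Limits.

(** * Contractive families and orthonormal bases *)

Section Families.
Context {R : realType} {H : hilbertType R}.
Implicit Types (f e w : nat -> H) (a : nat -> R[i]).

(** The synthesis map [a |-> \sum_n a n *: f n] is a contraction on square
    summable sequences; equivalently the Gram matrix of [f] is at most the
    identity. *)
Definition contractive f := forall N a,
  rn (\sum_(n < N) a n *: f n) ^+ 2 <= \sum_(n < N) rn (a n) ^+ 2.

Definition orthogonal_family e := forall n m, n != m -> hdot (e n) (e m) = 0.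

Lemma contractive_le1 f n : contractive f -> rn (f n) <= 1.
Proof.
move=> /(_ n.+1 (fun k => (k == n)%:R)); rewrite !big_ord_recr/= eqxx scale1r rn1.
rewrite !big1 ?add0r => [|i _|i _]; first by rewrite expr1n expr_le1// rn_ge0.
  by rewrite ltn_eqF// rn0 expr0n.
by rewrite ltn_eqF// scale0r.
Qed.

Lemma orthogonal_sum_sqr e N a : orthogonal_family e ->
  rn (\sum_(n < N) a n *: e n) ^+ 2 = \sum_(n < N) rn (a n) ^+ 2 * rn (e n) ^+ 2.
Proof.
move=> oe; elim: N => [|N IH]; first by rewrite !big_ord0 rn0 expr0n.
rewrite !big_ord_recr/= pythagoras ?IH ?rnZ ?exprMn//.
rewrite hdot_suml big1// => i _; rewrite hdotZl hdotZr oe ?mulr0//.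
by rewrite ltn_eqF.
Qed.

Lemma orthogonal_contractive e : orthogonal_family e -> (forall n, rn (e n) <= 1) ->
  contractive e.
Proof.
move=> oe e1 N a; rewrite orthogonal_sum_sqr//; apply: ler_sum => n _.
by rewrite ler_piMr ?sqr_ge0// expr_le1// rn_ge0.
Qed.

(** Test the contraction on the coefficients [hdot x (f n)] themselves. *)
Lemma bessel f x N : contractive f -> \sum_(n < N) rn (hdot x (f n)) ^+ 2 <= rn x ^+ 2.
Proof.
move=> /(_ N (fun n => hdot x (f n))); set S := \sum_(n < N) rn _ ^+ 2.
set y := \sum_(n < N) _ => yS.
have S0 : 0 <= S by apply: sumr_ge0 => n _; rewrite sqr_ge0.
have : complex.Re (hdot x y) = S.
  rewrite hdot_sumr cRe_sum; apply: eq_bigr => n _.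
  by rewrite hdotZr mulrC mulcJ.
have := leRe (hdot x y); have := cauchy_schwarz x y; move=> h1 h2 h3.
have Sxy : S <= rn x * rn y by lra.
have := rn_ge0 x; have := rn_ge0 y; move=> y0 x0.
have : S ^+ 2 <= rn x ^+ 2 * rn y ^+ 2.
  by rewrite -exprMn ler_pXn2r// nnegrE mulr_ge0.
have [->|Sn0] := eqVneq S 0; first by rewrite sqr_ge0.
have Sgt0 : 0 < S by rewrite lt_neqAle eq_sym Sn0.
move=> SS; rewrite -(ler_pM2r Sgt0) -expr2 (le_trans SS)//.
by rewrite ler_wpM2l// sqr_ge0.
Qed.

Lemma bessel_pair e w x y N : contractive e -> contractive w ->
  rn (\sum_(n < N) hdot (e n) x * hdot y (w n)) <= rn x * rn y.
Proof.
move=> ce cw; rewrite (le_trans (rn_sum _ _ _))//.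
under eq_bigr do rewrite rnM hdotC rnJ.
apply: (sum_cauchy_schwarz_le (x := fun n => rn (hdot x (e n)))
  (y := fun n => rn (hdot y (w n)))); rewrite ?rn_ge0//; exact: bessel.
Qed.

Lemma contractive_series_cvg f a S : contractive f ->
  (forall N, \sum_(n < N) rn (a n) ^+ 2 <= S) ->
  exists x : H, (fun N => \sum_(n < N) a n *: f n) @ \oo --> x.
Proof.
move=> cf aS; apply: (cauchy_series_cvg (u := fun n => a n *: f n)) => e e0.
have [N NP] := summable_tail (fun n => sqr_ge0 (rn (a n))) aS (exprn_gt0 2 e0).
exists N => m n Nm; rewrite -(@ltr_pXn2r _ 2) ?nnegrE ?rn_ge0 ?(ltW e0)//.
have [mn|nm] := leqP m n; last by rewrite big_geq ?(ltnW nm)// rn0 expr0n/= exprn_gt0.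
apply: le_lt_trans (NP n).
(* contractivity bounds sums starting at 0: use it with the first coefficients
   set to zero *)
pose a' k := if (m <= k)%N then a k else 0.
have := cf n a'; rewrite -(big_mkord xpredT (fun k => a' k *: f k)).
rewrite -(big_mkord xpredT (fun k => rn (a' k) ^+ 2)).
rewrite !(@big_cat_nat _ _ _ m 0 n)//= big_nat big1 ?add0r; last first.
  by move=> i /andP[_ im]; rewrite /a' leqNgt im scale0r.
rewrite [X in _ <= X + _]big_nat [X in _ <= X + _]big1 ?add0r; last first.
  by move=> i /andP[_ im]; rewrite /a' leqNgt im/= rn0 expr0n.
rewrite big_nat (eq_bigr (fun k => a k *: f k)) -?big_nat; last first.
  by move=> i /andP[mi _]; rewrite /a' mi.
move=> /le_trans; apply.
rewrite big_nat (eq_bigr (fun k => rn (a k) ^+ 2)) -?big_nat; last first.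
  by move=> i /andP[mi _]; rewrite /a' mi.
by rewrite (@big_cat_nat _ _ _ m N n)//= lerDr sumr_ge0// => ? _; rewrite sqr_ge0.
Qed.

End Families.

Section HdotLimits.
Context {R : realType} {H : hilbertType R}.

Lemma cvg_rn_bound (V W : normedModType R[i]) T (F : set_system T) {FF : Filter F}
    (f : T -> V) (g : T -> W) (l : V) (m : W) (M : R) :
  (forall t, rn (g t - m) <= M * rn (f t - l)) -> f @ F --> l -> g @ F --> m.
Proof.
move=> fg /cvg_rnP fl; apply/cvg_rnP => e e0.
have M1 : 0 < `|M| + 1 by rewrite ltr_wpDl.
have /fl : 0 < e / (`|M| + 1) by rewrite divr_gt0.
apply: filterS => t; rewrite ltr_pdivlMr// => h; apply: le_lt_trans h.
rewrite (le_trans (fg t))// mulrC ler_wpM2l ?rn_ge0//.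
by rewrite (le_trans (ler_norm _))// lerDl.
Qed.

Lemma cvg_hdotl T (F : set_system T) {FF : Filter F} (f : T -> H) (l y : H) :
  f @ F --> l -> (fun t => hdot (f t) y : R[i]^o) @ F --> (hdot l y : R[i]^o).
Proof.
by apply: (@cvg_rn_bound _ _ _ _ _ _ _ _ _ (rn y)) => t; rewrite -hdotBl mulrC cauchy_schwarz.
Qed.

Lemma cvg_hdotr T (F : set_system T) {FF : Filter F} (f : T -> H) (l y : H) :
  f @ F --> l -> (fun t => hdot y (f t) : R[i]^o) @ F --> (hdot y l : R[i]^o).
Proof.
by apply: (@cvg_rn_bound _ _ _ _ _ _ _ _ _ (rn y)) => t; rewrite -hdotBr cauchy_schwarz.
Qed.

End HdotLimits.

Section Basis.
Context {R : realType} {H : hilbertType R}.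
Variable b : nat -> H.
Hypothesis bP : orthonormal_basis b.

Lemma basis_orthogonal : orthogonal_family b. Proof. by case: bP. Qed.

Lemma basis_rn n : rn (b n) = 0 \/ rn (b n) = 1.
Proof. by case: bP => _ /(_ n)[->|bn] _; [left; rewrite rn0|right; rewrite /rn bn]. Qed.

Lemma basis_le1 n : rn (b n) <= 1.
Proof. by case: (basis_rn n) => ->. Qed.

Lemma basis_contractive : contractive b.
Proof. exact: orthogonal_contractive basis_orthogonal basis_le1. Qed.

Lemma basis_idem n : hdot (b n) (b n) *: b n = b n.
Proof.
rewrite hdotE; case: (basis_rn n) => [b0|->]; last by rewrite expr1n scale1r.
by rewrite (rn0_eq0 b0) scaler0.
Qed.

(** The Fourier series converges by Bessel, and the difference with [x] is
    orthogonal to the basis. *)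
Lemma basis_expansion x : (fun N => \sum_(n < N) hdot x (b n) *: b n) @ \oo --> x.
Proof.
have [x' x'P] := contractive_series_cvg (a := fun n => hdot x (b n)) basis_contractive
  (fun N => bessel x N basis_contractive).
suff xx' : x = x' by rewrite [X in _ --> X]xx'; exact: x'P.
apply/eqP; rewrite -subr_eq0; apply/eqP; case: (bP) => _ _; apply => k.
rewrite hdotBl; apply/eqP; rewrite subr_eq0; apply/eqP.
apply: (@limn_unique _ R[i]^o _ \oo _ (fun N => hdot (\sum_(n < N) hdot x (b n) *: b n) (b k))).
  apply: (@cvg_rnP _ R[i]^o _ _ _ _ _).2 => e e0; exists k.+1 => // N /= kN.
  rewrite hdot_suml (bigD1 (Ordinal kN))//= big1 ?addr0 => [|i ik]; last first.
    by rewrite hdotZl basis_orthogonal ?mulr0.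
  have -> : hdot (hdot x (b k) *: b k) (b k) = hdot x (b k).
    by rewrite -[in RHS]basis_idem hdotZr hdotZl hdotE conjc_real mulrC.
  by rewrite subrr rn0.
exact: cvg_hdotl x'P.
Qed.

Lemma parseval x y : has_sum (fun n => hdot x (b n) * hdot (b n) y) (hdot x y).
Proof.
have : (fun N => hdot (\sum_(n < N) hdot x (b n) *: b n) y : R[i]^o) @ \oo -->
    (hdot x y : R[i]^o) by exact: cvg_hdotl (basis_expansion (x := x)).
rewrite (_ : (fun N => hdot (\sum_(n < N) hdot x (b n) *: b n) y : R[i]^o) =
  (fun N => \sum_(n < N) hdot x (b n) * hdot (b n) y : R[i]^o))//.
by apply/funext => N; rewrite hdot_suml; apply: eq_bigr => n _; rewrite hdotZl.
Qed.

(** Riesz representation: the partial sums of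
    [\sum_n (phi (b n))^* *: b n] are bounded by the norm of [phi]. *)
Lemma riesz (phi : H -> R[i]) (M : R) :
  (forall a x y, phi (a *: x + y) = a * phi x + phi y) ->
  (forall x, rn (phi x) <= M * rn x) ->
  exists z, forall x, phi x = hdot x z.
Proof.
move=> phiP phiM.
have phi0 : phi 0 = 0.
  by have := phiP 1 0 0; rewrite scale1r addr0 mul1r => h; apply: (addrI (phi 0)); rewrite addr0 -h.
have phi_sum N (a : nat -> R[i]) :
    phi (\sum_(n < N) a n *: b n) = \sum_(n < N) a n * phi (b n).
  elim: N => [|N IH]; first by rewrite !big_ord0.
  by rewrite !big_ord_recr/= addrC phiP IH addrC.
have M0 : 0 <= `|M| by [].
have phi_bd N : \sum_(n < N) rn (phi (b n))^*%C ^+ 2 <= `|M| ^+ 2.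
  set S := (X in X <= _).
  have S0 : 0 <= S by apply: sumr_ge0 => n _; rewrite sqr_ge0.
  set s := \sum_(n < N) (phi (b n))^*%C *: b n.
  have sS : rn s ^+ 2 <= S by have /(_ N (fun n => (phi (b n))^*%C)) := basis_contractive.
  have phis : phi s = S%:C.
    rewrite /s (phi_sum N (fun n => (phi (b n))^*%C)) /S (big_morph (fun r : R => r%:C) (fun x y => realcD x y) erefl).
    by apply: eq_bigr => n _; rewrite mulrC mulcJ rnJ.
  have := phiM s; rewrite phis rn_real ger0_norm// => SM.
  have SM2 : S <= `|M| * rn s.
    by rewrite (le_trans SM)// ler_wpM2r ?rn_ge0 ?ler_norm.
  have [->|Sn0] := eqVneq S 0; first by rewrite sqr_ge0.
  have Sgt0 : 0 < S by rewrite lt_neqAle eq_sym Sn0.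
  rewrite -(ler_pM2r Sgt0) (@le_trans _ _ (`|M| ^+ 2 * rn s ^+ 2))//; last first.
    by rewrite ler_wpM2l// sqr_ge0.
  by rewrite -expr2 -exprMn ler_pXn2r// nnegrE mulr_ge0// rn_ge0.
have [z zP] := contractive_series_cvg (a := fun n => (phi (b n))^*%C) basis_contractive phi_bd.
exists z => x.
apply: (@limn_unique _ R[i]^o _ \oo _ (fun N => phi (\sum_(n < N) hdot x (b n) *: b n))); last first.
  have : (fun N => hdot x (\sum_(n < N) (phi (b n))^*%C *: b n) : R[i]^o) @ \oo -->
    (hdot x z : R[i]^o) by exact: cvg_hdotr zP.
  rewrite (_ : (fun N => phi (\sum_(n < N) hdot x (b n) *: b n) : R[i]^o) =
    (fun N => hdot x (\sum_(n < N) (phi (b n))^*%C *: b n) : R[i]^o))//.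
  apply/funext => N; rewrite (phi_sum N (fun n => hdot x (b n))) hdot_sumr; apply: eq_bigr => n _.
  by rewrite hdotZr conjcK mulrC.
have : (fun N => phi (\sum_(n < N) hdot x (b n) *: b n) : R[i]^o) @ \oo --> (phi x : R[i]^o).
  apply: cvg_rn_bound (basis_expansion (x := x)) => N.
  rewrite (_ : phi _ - phi x = phi (\sum_(n < N) hdot x (b n) *: b n - x)); first exact: phiM.
  by rewrite [in RHS]addrC -[- x]scaleN1r phiP mulN1r addrC.
exact.
Qed.

(** Apply Riesz for each fixed first argument.  Adjoints and diagonal operators
    are all obtained in this way, from their forms. *)
Lemma form_operator (B : H -> H -> R[i]) (M : R) :
  (forall a x y z, B (a *: x + y) z = a * B x z + B y z) ->
  (forall a x y z, B z (a *: x + y) = a^*%C * B z x + B z y) ->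
  (forall x y, rn (B x y) <= M * (rn x * rn y)) ->
  exists2 T : {linear H -> H}, continuous T & forall x y, hdot (T x) y = B x y.
Proof.
move=> Bl Br BM.
have /choice[f fP] x : exists z, forall y, (B x y)^*%C = hdot y z.
  apply: (@riesz _ (M * rn x)) => [a y z|y]; last by rewrite rnJ -mulrA.
  by rewrite Br conjcD conjcM conjcK.
have fE x y : hdot (f x) y = B x y by rewrite hdotC -fP conjcK.
have flin : linear f.
  by move=> a x y; apply: hdot_ext => z; rewrite hdotDZl !fE Bl.
pose T : {linear H -> H} := HB.pack f (GRing.isLinear.Build _ _ _ _ f flin).
exists T => [|x y]; last exact: fE.
apply/continuous_boundedP; exists `|M| => // x.
have [->|x0] := eqVneq (rn (T x)) 0; first by rewrite mulr_ge0// rn_ge0.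
have Tx0 : 0 < rn (T x) by rewrite lt_neqAle eq_sym x0 rn_ge0.
rewrite -(ler_pM2r Tx0) -expr2.
have := BM x (T x); rewrite -fE hdotE rn_real ger0_norm ?sqr_ge0// => /le_trans; apply.
by rewrite mulrA ler_wpM2r ?rn_ge0// ler_wpM2r ?rn_ge0// ler_norm.
Qed.

Lemma adjoint_exists (T : {linear H -> H}) : continuous T ->
  exists2 S : {linear H -> H}, continuous S & forall x y, hdot (T x) y = hdot x (S y).
Proof.
move=> /continuous_boundedP[M M0 TM].
have [S Sc SP] : exists2 S : {linear H -> H}, continuous S &
    forall x y, hdot (S x) y = hdot x (T y).
  apply: (form_operator (M := M)) => [a x y z|a x y z|x y]; first exact: hdotDZl.
    by rewrite linearP hdotDr hdotZr.
  by rewrite (le_trans (cauchy_schwarz _ _))// mulrCA ler_wpM2l ?rn_ge0.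
by exists S => // x y; rewrite hdotC -SP -hdotC.
Qed.

Lemma adjointP (T : {linear H -> H}) : continuous T ->
  continuous (adjoint T) /\ forall x y, hdot (T x) y = hdot x (adjoint T y).
Proof.
move=> /adjoint_exists[S Sc SP].
exact: (@xgetPex _ (\0 : {linear H -> H}) [set S : {linear H -> H} | continuous S /\
   forall x y, hdot (T x) y = hdot x (S y)] (ex_intro _ S (conj Sc SP))).
Qed.

End Basis.

(** * Orthonormal bases of separable spaces *)

(** Sequences built one term at a time: the choice of a term may use the earlier
    terms, and those are known to have been chosen correctly. *)
Lemma recursive_choice (T : choiceType) (x0 : T) (Q : seq T -> T -> Prop) :
  (forall s, (forall k, (k < size s)%N -> Q (take k s) (nth x0 s k)) -> exists x, Q s x) ->
  exists g : nat -> T, forall n, Q (mkseq g n) (g n).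
Proof.
move=> QP; pose next s := xget x0 (Q s).
pose sq := fix sq n := if n is m.+1 then rcons (sq m) (next (sq m)) else [::].
exists (fun n => next (sq n)) => n.
have sqE m : sq m = mkseq (fun n => next (sq n)) m.
  by elim: m => // m IH; rewrite mkseqS -IH.
rewrite -sqE; elim/ltn_ind: n => n IH.
have [x Qx] : exists x, Q (sq n) x.
  apply: QP => k; rewrite sqE size_mkseq => kn.
  rewrite nth_mkseq// (_ : take k _ = sq k); first exact: IH.
  by rewrite sqE /mkseq -map_take take_iota (minn_idPl (ltnW kn)).
exact: (xgetPex x0 (ex_intro _ x Qx)).
Qed.

Section BasisExists.
Context {R : realType} {H : hilbertType R}.

Lemma rn_normalize (y : H) : y != 0 -> rn ((rn y)^-1%:C *: y) = 1.
Proof.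
move=> y0; have yn0 : rn y != 0 by apply: contra_neq y0 => /rn0_eq0.
by rewrite rnZ rn_real ger0_norm ?invr_ge0 ?rn_ge0// mulVf.
Qed.

(** Gram-Schmidt applied to a dense sequence, with zero vectors where the
    sequence adds no new direction. *)
Lemma separable_basis : separable H -> exists b : nat -> H, orthonormal_basis b.
Proof.
move=> [D [/countable_injP[f finj] Dd]].
pose d n := xget (0 : H) [set y | D y /\ f y = n].
have dP y : D y -> d (f y) = y.
  move=> Dy; have [] := @xgetPex _ (0 : H) [set z | D z /\ f z = f y] (ex_intro _ y (conj Dy erefl)).
  by move=> Dd' fd; apply: finj => //; rewrite inE.
pose Q (s : seq H) (x : H) := [/\ forall k, (k < size s)%N -> hdot x (nth 0 s k) = 0,
  x = 0 \/ rn x = 1 & forall z, (forall k, (k < size s)%N -> hdot z (nth 0 s k) = 0) ->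
    hdot z x = 0 -> hdot z (d (size s)) = 0].
have [b bQ] : exists b : nat -> H, forall n, Q (mkseq b n) (b n).
  apply: (@recursive_choice _ 0) => s sP.
  set N := size s in sP *.
  have so i j : (i < N)%N -> (j < i)%N -> hdot (nth 0 s i) (nth 0 s j) = 0.
    move=> iN ji; have [/(_ j) + _ _] := sP _ iN.
    by rewrite size_takel ?(ltnW iN)// nth_take//; exact.
  have so' i j : (i < N)%N -> (j < N)%N -> i != j -> hdot (nth 0 s i) (nth 0 s j) = 0.
    move=> iN jN; rewrite neq_ltn => /orP[ij|ji]; last exact: so.
    by rewrite hdotC so ?conjc0.
  have sn i : (i < N)%N -> nth 0 s i = 0 \/ rn (nth 0 s i) = 1.
    by move=> iN; have [_ + _] := sP _ iN.
  pose y := d N - \sum_(k < N) hdot (d N) (nth 0 s k) *: nth 0 s k.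
  have yo k : (k < N)%N -> hdot y (nth 0 s k) = 0.
    move=> kN; rewrite hdotBl hdot_suml (bigD1 (Ordinal kN))//= big1 ?addr0; last first.
      by move=> i ik; rewrite hdotZl so' ?mulr0.
    rewrite hdotZl; have [->|k1] := sn _ kN; first by rewrite !hdot0r mul0r subr0.
    by rewrite [hdot (nth _ _ _) _]hdotE k1 expr1n mulr1 subrr.
  have dE z : (forall k, (k < N)%N -> hdot z (nth 0 s k) = 0) -> hdot z (d N) = hdot z y.
    move=> zs; rewrite hdotBr hdot_sumr big1 ?subr0// => i _.
    by rewrite hdotZr zs ?mulr0.
  have [y0|y0] := eqVneq y 0.
    by exists 0; split=> [k _||z /dE -> _]; rewrite ?hdot0l// ?y0 ?hdot0r//; left.
  exists ((rn y)^-1%:C *: y); split=> [k kN||z /dE ->].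
  - by rewrite hdotZl yo// mulr0.
  - by right; exact: rn_normalize.
  - rewrite hdotZr conjc_real => /eqP; rewrite mulf_eq0 => /orP[|/eqP//].
    rewrite -[0]/(0%:C) (inj_eq (@complexI _)) invr_eq0 => /eqP/rn0_eq0 y00.
    by rewrite y00 eqxx in y0.
exists b.
have bo i j : (j < i)%N -> hdot (b i) (b j) = 0.
  by move=> ji; have [/(_ j) + _ _] := bQ i; rewrite size_mkseq nth_mkseq//; exact.
split.
- move=> i j; rewrite neq_ltn => /orP[ij|]; last exact: bo.
  by rewrite hdotC bo ?conjc0.
- move=> n; have [_ [bn|bn] _] := bQ n; first by left.
  by right; rewrite rnE bn.
- move=> x xb.
  have xd n : hdot x (d n) = 0.
    have [_ _] := bQ n; rewrite size_mkseq; apply; last exact: xb.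
    by move=> k kn; rewrite nth_mkseq.
  apply/eqP/negP => /negP x0.
  have rx : 0 < rn x by rewrite lt_neqAle rn_ge0 andbT; apply: contra_neq x0 => /esym/rn0_eq0.
  have [||y []] := Dd (ball x (rn x)%:C).
  + by exists x; apply: ballxx; rewrite ltcR.
  + exact: ball_open.
  rewrite -ball_normE/= rnE ltcR => xy /dP dy.
  have := rnBsqr x y; rewrite -[in X in _ * X]dy xd mulr0 subr0 => h.
  have : rn (x - y) ^+ 2 < rn x ^+ 2 by rewrite ltr_pXn2r// ?nnegrE ?rn_ge0.
  by rewrite h ltNge lerDl sqr_ge0.
Qed.

End BasisExists.

(** * The absolute value of an operator *)

(** The square root of [T^* T] is needed for every bounded [T]: the trace norm
    is a condition on [|T|], and compactness of [T] is a consequence of it. *)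
Section SquareRoot.
Context {R : realType} {H : hilbertType R}.
Variable b : nat -> H.
Hypothesis bP : orthonormal_basis b.

(** With [K = 1 - B], the root of [B] is [1 - Y] where [Y] is the limit of
    [Y' = (K + Y ^ 2) / 2]; the same recursion on scalars, started at [K = 1],
    bounds the increments. *)
Section Iteration.
Variable K : H -> H.
Hypothesis Klin : linear K.
Hypothesis Ksym : forall x y, hdot (K x) y = hdot x (K y).
Hypothesis K1 : forall x, rn (K x) <= rn x.

Fixpoint sqrt_iter n (x : H) : H :=
  if n is m.+1 then (2^-1)%:C *: (K x + sqrt_iter m (sqrt_iter m x)) else 0.

Fixpoint sqrt_majorant n : R := if n is m.+1 then 2^-1 * (1 + sqrt_majorant m ^+ 2) else 0.

Let Y := sqrt_iter.
Let y := sqrt_majorant.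

Lemma sqrt_iter_linear n : linear (Y n).
Proof.
elim: n => [|n IH] a u v; rewrite /Y/=; first by rewrite scaler0 addr0.
rewrite Klin /= [sqrt_iter n (_ + _)]IH [sqrt_iter n (_ + _)]IH.
rewrite scalerA mulrC -scalerA -scalerDr; congr (_ *: _).
by rewrite scalerDr addrACA.
Qed.

Lemma sqrt_iter_sym n u v : hdot (Y n u) v = hdot u (Y n v).
Proof.
elim: n u v => [|n IH] u v; rewrite /Y/=; first by rewrite hdot0l hdot0r.
by rewrite hdotZl hdotZr conjc_real hdotDl hdotDr Ksym [hdot (sqrt_iter _ _) _]IH [hdot (sqrt_iter _ _) _]IH.
Qed.

Lemma sqrt_majorant01 n : 0 <= y n <= 1.
Proof.
elim: n => [|n /andP[]]; rewrite /y/=; first by rewrite lexx ler01.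
set t := sqrt_majorant n => t0 t1.
by apply/andP; split; nra.
Qed.

Lemma sqrt_majorant_nondecr n : y n <= y n.+1.
Proof.
have /andP[] := sqrt_majorant01 n; rewrite /y/=; set t := sqrt_majorant n => t0 t1.
by have := sqr_ge0 (1 - t); nra.
Qed.

Lemma sqrt_iter_le n x : rn (Y n x) <= y n * rn x.
Proof.
elim: n x => [|n IH] x; rewrite /Y/y/=; first by rewrite rn0 mul0r.
rewrite rnZ rn_real ger0_norm ?invr_ge0// -mulrA ler_wpM2l ?invr_ge0//.
rewrite (le_trans (rnD _ _))// mulrDl mul1r lerD// (le_trans (IH _))//.
by rewrite expr2 -mulrA ler_wpM2l//; have /andP[] := sqrt_majorant01 n.
Qed.

Lemma sqrt_iter_diff n x : rn (Y n.+1 x - Y n x) <= (y n.+1 - y n) * rn x.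
Proof.
elim: n x => [|n IH] x.
  rewrite /Y/y/= subr0 addr0 expr0n/= addr0 mulr1 subr0 rnZ rn_real.
  by rewrite ger0_norm ?invr_ge0// ler_wpM2l// invr_ge0.
have Yadd m u v : Y m (u - v) = Y m u - Y m v.
  by rewrite addrC -scaleN1r sqrt_iter_linear scaleN1r addrC.
have -> : Y n.+2 x - Y n.+1 x = (2^-1)%:C *:
    (Y n.+1 (Y n.+1 x - Y n x) + (Y n.+1 (Y n x) - Y n (Y n x))).
  have YS m v : Y m.+1 v = (2^-1)%:C *: (K v + Y m (Y m v)) by [].
  by rewrite Yadd subrKA [Y n.+2 x]YS [X in _ - X = _](YS n x) -scalerBr opprD addrACA subrr add0r.
have -> : y n.+2 - y n.+1 = 2^-1 * (y n.+1 * (y n.+1 - y n) + (y n.+1 - y n) * y n).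
  have yS m : y m.+1 = 2^-1 * (1 + y m ^+ 2) by [].
  by rewrite [y n.+2]yS [X in _ - X = _](yS n); ring.
rewrite rnZ rn_real ger0_norm ?invr_ge0// -mulrA ler_wpM2l ?invr_ge0//.
rewrite (le_trans (rnD _ _))// mulrDl lerD//.
  rewrite (le_trans (sqrt_iter_le _ _))// -mulrA ler_wpM2l//.
  by have /andP[] := sqrt_majorant01 n.+1.
rewrite (le_trans (IH _))// -mulrA ler_wpM2l//.
  by rewrite subr_ge0 sqrt_majorant_nondecr.
exact: sqrt_iter_le.
Qed.

(** The increments of the recursion are dominated by a telescoping series. *)
Lemma sqrt_limit : exists Z : H -> H, [/\ linear Z,
  forall u v, hdot (Z u) v = hdot u (Z v), forall x, rn (Z x) <= rn x
  & forall x, Z x + Z x = K x + Z (Z x)].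
Proof.
have Yc x : exists z : H, (fun n => Y n x) @ \oo --> z.
  have gS N : \sum_(n < N) (y n.+1 - y n) * rn x <= rn x.
    rewrite -mulr_suml -(big_mkord xpredT (fun k => y k.+1 - y k)).
    rewrite telescope_sumr// subr0 ler_piMl ?rn_ge0//.
    by have /andP[] := sqrt_majorant01 N.
  have [z zP] := abs_series_cvg (fun n => sqrt_iter_diff n x) gS.
  exists z; move: zP; rewrite (_ : (fun n => Y n x) =
    (fun N => \sum_(n < N) (Y n.+1 x - Y n x)))//.
  apply/funext => N; rewrite -(big_mkord xpredT (fun k => Y k.+1 x - Y k x)).
  by rewrite telescope_sumr// subr0.
have [Z ZP] := choice Yc.
have Z1 x : rn (Z x) <= rn x.
  rewrite -[Z x]subr0; apply: cvg_rn_le (ZP x) _; near=> n.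
  rewrite subr0 (le_trans (sqrt_iter_le _ _))// ler_piMl ?rn_ge0//.
  by have /andP[] := sqrt_majorant01 n.
have Zlin : linear Z.
  move=> a u v; apply: (limn_unique (F := \oo)) (ZP _) _.
  under eq_fun do rewrite sqrt_iter_linear.
  by apply: cvgD (ZP v); apply: cvgZl_tmp; exact: ZP.
exists Z; split=> //.
  move=> u v; apply: (@limn_unique _ R[i]^o _ \oo _ (fun n => hdot (Y n u) v)).
    exact: cvg_hdotl (ZP u).
  under eq_fun do rewrite sqrt_iter_sym.
  exact: cvg_hdotr (ZP v).
move=> x; have YY : (fun n => Y n (Y n x)) @ \oo --> Z (Z x).
  have h : (fun n => Y n (Y n x) - Y n (Z x)) @ \oo --> (0 : H).
    have Yx : (fun n => Y n x) @ \oo --> Z x := ZP x.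
    apply: (cvg_rn_bound (M := 1)) Yx => n; rewrite subr0 mul1r.
    have -> : Y n (Y n x) - Y n (Z x) = Y n (Y n x - Z x).
      by rewrite [in RHS]addrC -[- Z x]scaleN1r sqrt_iter_linear scaleN1r addrC.
    rewrite (le_trans (sqrt_iter_le _ _))// ler_piMl ?rn_ge0//.
    by have /andP[] := sqrt_majorant01 n.
  have -> : (fun n => Y n (Y n x)) = (fun n => (Y n (Y n x) - Y n (Z x)) + Y n (Z x)).
    by apply/funext => n; rewrite subrK.
  by rewrite -[Z (Z x)]add0r; exact: cvgD h (ZP (Z x)).
have h1 : (fun n => Y n.+1 x) @ \oo --> Z x.
  by have := ZP x; rewrite -(cvg_shiftS (fun n => Y n x)).
have h2 : (fun n => Y n.+1 x) @ \oo --> (2^-1)%:C *: (K x + Z (Z x)).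
  by apply: cvgZl_tmp; apply: cvgD YY; exact: cvg_cst.
have e : Z x = (2^-1)%:C *: (K x + Z (Z x)) by exact: (limn_unique h1 h2).
rewrite {1 2}e -scalerDl -realcD (_ : 2^-1 + 2^-1 = 1 :> R) ?scale1r//.
by lra.
Unshelve. all: by end_near. Qed.
End Iteration.

(** Apply the iteration to [K = 1 - T^* T / M ^ 2] with [M] above the norm of
    [T]. *)
Lemma abs_exists (T : {linear H -> H}) : continuous T ->
  exists P : {linear H -> H}, [/\ continuous P, positive P & P \o P =1 adjoint T \o T].
Proof.
move=> Tc; have [_ TP] := adjointP bP Tc.
have [M M0 TM] : exists2 M : R, 0 < M & forall x, rn (T x) <= M * rn x.
  have [M M0 TM] := (continuous_boundedP T).1 Tc.
  exists (M + 1) => [|x]; first by rewrite ltr_wpDl.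
  by rewrite (le_trans (TM x))// ler_wpM2r ?rn_ge0// lerDl.
have Mn0 : M != 0 by rewrite gt_eqF.
set S := adjoint T in TP *.
have SM x : rn (S x) <= M * rn x.
  have [->|Sx0] := eqVneq (rn (S x)) 0; first by rewrite mulr_ge0 ?rn_ge0// ltW.
  have Sx : 0 < rn (S x) by rewrite lt_neqAle eq_sym Sx0 rn_ge0.
  rewrite -(ler_pM2r Sx) -expr2 -Re_hdot -TP (le_trans (leRe _))//.
  rewrite (le_trans (cauchy_schwarz _ _))// mulrAC ler_wpM2r ?rn_ge0//.
pose m : R := (M ^+ 2)^-1.
have m0 : 0 < m by rewrite invr_gt0 exprn_gt0.
pose K x := x - m%:C *: S (T x).
have Klin : linear K.
  by move=> a u v; rewrite /K !linearP/= scalerDr addrACA.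
have Ksym u v : hdot (K u) v = hdot u (K v).
  rewrite /K hdotBl hdotBr hdotZl hdotZr conjc_real -TP; congr (_ - _ * _).
  by rewrite hdotC -TP -hdotC.
(* in the expansion of [rn (K u) ^+ 2] the term [m ^ 2 * rn (T^* T u) ^ 2] is at
   most [m * rn (T u) ^ 2], and the mixed term subtracts twice that *)
have K1 u : rn (K u) <= rn u.
  apply: ler_of_sqr; first exact: rn_ge0.
  rewrite /K rnBsqr hdotZr conjc_real cReMl -TP Re_hdot rnZ rn_real gtr0_norm//.
  have h : rn (S (T u)) ^+ 2 <= M ^+ 2 * rn (T u) ^+ 2.
    by rewrite -exprMn ler_pXn2r ?nnegrE ?mulr_ge0 ?rn_ge0// ltW.
  have mM : m * M ^+ 2 = 1 by rewrite /m mulVf// expf_eq0.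
  have := sqr_ge0 (rn (T u)); move: h mM m0; rewrite exprMn.
  set p := rn (S _) ^+ 2; set q := rn (T u) ^+ 2; set M2 := M ^+ 2.
  move=> h mM m0 q0.
  have : m ^+ 2 * p <= m * q.
    have -> : m * q = m ^+ 2 * (M2 * q) by rewrite expr2 -mulrA [m * (M2 * _)]mulrA mM mul1r.
    by rewrite ler_wpM2l// sqr_ge0.
  have : 0 <= m * q by rewrite mulr_ge0// ltW.
  lra.
have [Z [Zlin Zsym Z1 ZK]] := sqrt_limit Klin Ksym K1.
pose P x := M%:C *: (x - Z x).
have Plin : linear P.
  move=> a u v; rewrite /P Zlin opprD addrACA -scalerBr scalerDr !scalerA.
  by rewrite [M%:C * a]mulrC.
pose PL : {linear H -> H} := HB.pack P (GRing.isLinear.Build _ _ _ _ P Plin).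
have ZB u v : Z (u - v) = Z u - Z v.
  by rewrite addrC -scaleN1r Zlin scaleN1r addrC.
have ZZ a u : Z (a *: u) = a *: Z u.
  by rewrite -[a *: u]addr0 -[X in _ + X](subrr 0) Zlin ZB subrr addr0.
exists PL; split.
- apply/continuous_boundedP; exists (2 * M) => [|x]; first by rewrite mulr_ge0// ltW.
  rewrite /= /P rnZ rn_real gtr0_norm// mulrAC [leRHS]mulrC ler_wpM2l ?(ltW M0)//.
  by rewrite (le_trans (rnD _ _))// rnN mulrDl mul1r lerD.
- move=> x; rewrite /= /P hdotZl mulr_ge0 ?ler0c ?(ltW M0)//.
  have Zx : complex.Im (hdot (Z x) x) = 0.
    have : hdot (Z x) x = (hdot (Z x) x)^*%C by rewrite -hdotC Zsym.
    by case: (hdot _ _) => u v [] /= /eqP; rewrite -addr_eq0 -mulr2n mulrn_eq0/= => /eqP.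
  rewrite hdotBl hdotE lecE/=.
  have := leRe (hdot (Z x) x); have := cauchy_schwarz (Z x) x; move: Zx.
  case: (hdot (Z x) x) => u v /= ->; rewrite subr0 eqxx/= subr_ge0 => h1 h2.
  by rewrite (le_trans h2)// (le_trans h1)// expr2 ler_wpM2r ?rn_ge0.
- move=> x; rewrite /= /P ZZ -scalerBr scalerA -realcM -expr2 ZB.
  have -> : x - Z x - (Z x - Z (Z x)) = x - K x.
    have -> : K x = Z x + Z x - Z (Z x) by rewrite ZK addrK.
    by rewrite !opprD !opprK !addrA.
  rewrite /K opprB addrCA subrr addr0 scalerA -realcM /m divff ?scale1r//.
  by rewrite expf_eq0.
Qed.

Lemma opabsP (T : {linear H -> H}) : continuous T ->
  [/\ continuous (opabs T), positive (opabs T) & opabs T \o opabs T =1 adjoint T \o T].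
Proof.
by move=> /abs_exists; exact: (@xgetPex _ (\0 : {linear H -> H})
  [set P : {linear H -> H} | [/\ continuous P, positive P &
      P \o P =1 adjoint T \o T]]).
Qed.

(** Polarization: the quadratic form is real at [x + y] and at [x + i y]. *)
Lemma positive_selfadjoint (P : {linear H -> H}) : positive P -> selfadjoint P.
Proof.
move=> Pp; have imP x : complex.Im (hdot (P x) x) = 0 by exact: ger0_Im.
move=> x y.
have h1 := imP (x + y); have h2 := imP (x + 'i%C *: y).
have ImD (a c : R[i]) : complex.Im (a + c) = complex.Im a + complex.Im c.
  by case: a c => [? ?] [].
move: h1 h2; rewrite !linearD/= linearZ/= !hdotDl !hdotDr !hdotZl !hdotZr !ImD.
rewrite mulrA [_ * 'i^*%C](_ : _ = 1); last first.
  by apply/eqP; rewrite eq_complex/=; apply/andP; split; apply/eqP; ring.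
rewrite mul1r !imP [hdot x (P y)]hdotC.
case: (hdot (P x) y) => p q; case: (hdot (P y) x) => r s /=.
by move=> h1 h2; congr (_ +i* _); lra.
Qed.

Lemma rn_opabs (T : {linear H -> H}) x : continuous T -> rn (opabs T x) = rn (T x).
Proof.
move=> Tc; have [_ TP] := adjointP bP Tc; have [_ Pp PP] := opabsP Tc.
have : hdot (opabs T x) (opabs T x) = hdot (T x) (T x).
  by rewrite (positive_selfadjoint Pp) -/((opabs T \o opabs T) x) PP/= TP.
move=> /(congr1 (@complex.Re R)); rewrite !Re_hdot => /eqP.
by rewrite eqrXn2 ?rn_ge0// => /eqP.
Qed.

End SquareRoot.

(** * Weak limits and the spectral theorem *)

Lemma ultra_fmap (S T : Type) (f : S -> T) (U : set_system S) :
  UltraFilter U -> UltraFilter (f @ U).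
Proof.
move=> UU; have UP : ProperFilter U by exact: ultra_proper.
split; first exact: fmap_proper_filter.
move=> G GP UG; apply/seteqP; split => // A GA.
have [//|nA] := in_ultra_setVsetC (f @^-1` A) UU.
have GnA : G (~` A) by apply: UG.
have GF : G (A `&` ~` A) by apply: filterI.
by have [x []] := filter_ex GF.
Qed.

Section WeakLimits.
Context {R : realType} {H : hilbertType R}.
Variable U : set_system nat.
Hypothesis UU : UltraFilter U.

Let UP : ProperFilter U. Proof. exact: ultra_proper. Qed.
Existing Instance UP.

Lemma bounded_ultralimit (z : nat -> R[i]) (M : R) : (forall k, rn (z k) <= M) ->
  exists l : R[i], (z : nat -> R[i]^o) @ U --> (l : R[i]^o).
Proof.
move=> zM.
have real_lim (x : nat -> R) : (forall k, `|x k| <= M) -> exists l : R, x @ U --> l.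
  move=> xM; have := @segment_compact R (- M) M; rewrite compact_ultra /= => cM.
  have [|l [_ xl]] := cM _ (ultra_fmap x UU); last by exists l.
  change (U (x @^-1` `[- M, M])).
  by apply: filterE => k /=; rewrite in_itv/= -ler_norml; exact: xM.
have [r rP] := real_lim (fun k => complex.Re (z k)) (fun k => le_trans (normRe _) (zM k)).
have [t tP] := real_lim (fun k => complex.Im (z k)) (fun k => le_trans (normIm _) (zM k)).
exists (r +i* t); apply/cvg_rnP => e e0.
have e2 : 0 < e / 2 by rewrite divr_gt0.
move/cvgrPdist_lt : rP => /(_ _ e2) r2.
move/cvgrPdist_lt : tP => /(_ _ e2); apply: filterS2 r2 => k r2 t2.
rewrite (le_lt_trans (rn_le_ReIm _))// [ltRHS]splitr.
by move: r2 t2; case: (z k) => p q /= r2 t2; rewrite ltrD// distrC.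
Qed.

Definition weak_cvg (x : nat -> H) (l : H) :=
  forall y, (fun k => hdot (x k) y : R[i]^o) @ U --> (hdot l y : R[i]^o).

Lemma weak_cvg_le x l M : (forall k, rn (x k) <= M) -> weak_cvg x l -> rn l <= M.
Proof.
move=> xM xl; have M0 : 0 <= M by apply: le_trans (xM 0%N); exact: rn_ge0.
have := cvg_rn_le (x := 0 : R[i]^o) (M := M * rn l) (xl l) _.
rewrite subr0 => h; have {h} : rn (hdot l l) <= M * rn l.
  apply: h; near=> k; rewrite subr0 (le_trans (cauchy_schwarz _ _))//.
  by rewrite ler_wpM2r ?rn_ge0.
rewrite hdotE rn_real ger0_norm ?sqr_ge0// expr2.
have [->|l0] := eqVneq (rn l) 0; first by [].
by rewrite ler_pM2r// lt_neqAle eq_sym l0 rn_ge0.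
Unshelve. all: by end_near. Qed.

Lemma weak_cvg_comb N (a : nat -> R[i]) (x : nat -> nat -> H) (l : nat -> H) :
  (forall n, weak_cvg (x n) (l n)) ->
  weak_cvg (fun k => \sum_(n < N) a n *: x n k) (\sum_(n < N) a n *: l n).
Proof.
move=> xl y; elim: N => [|N IH].
  under eq_fun do rewrite big_ord0 hdot0l.
  by rewrite big_ord0 hdot0l; exact: cvg_cst.
under eq_fun do rewrite big_ord_recr/= hdotDl hdotZl.
rewrite big_ord_recr/= hdotDl hdotZl; apply: (@cvgD _ R[i]^o) IH _.
exact: (@cvgZl_tmp _ R[i]^o _ _ _ (a N) _ _ (xl N y)).
Qed.

Variable b : nat -> H.
Hypothesis bP : orthonormal_basis b.

(** Scalar products with a fixed vector are bounded, hence converge along the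
    ultrafilter; their limits form a bounded functional, to which Riesz applies. *)
Lemma weak_compactness (x : nat -> H) (M : R) : (forall k, rn (x k) <= M) ->
  exists l, weak_cvg x l.
Proof.
move=> xM.
have /choice[phi phiP] y : exists l : R[i],
    (fun k => hdot y (x k) : R[i]^o) @ U --> (l : R[i]^o).
  apply: (@bounded_ultralimit _ (rn y * M)) => k.
  by rewrite (le_trans (cauchy_schwarz _ _))// ler_wpM2l ?rn_ge0.
have [||l lP] := @riesz _ _ _ bP phi M.
- move=> a y z; apply: (@limn_unique _ R[i]^o _ U _ _ _ _ (phiP _)).
  under eq_fun do rewrite hdotDZl.
  by apply: (@cvgD _ R[i]^o) (phiP z); exact: (@cvgZl_tmp _ R[i]^o _ _ _ a _ _ (phiP y)).
- move=> y; rewrite -[phi y]subr0; apply: (cvg_rn_le (V := R[i]^o) (phiP y)).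
  near=> k; rewrite subr0 (le_trans (cauchy_schwarz _ _))// mulrC.
  by rewrite ler_wpM2r ?rn_ge0.
exists l => y; rewrite hdotC -lP.
apply: (@cvg_rn_bound _ R[i]^o R[i]^o _ U _ _ _ _ _ 1) (phiP y) => k.
by rewrite mul1r hdotC -rnJ conjcD conjcN !conjcK.
Unshelve. all: by end_near. Qed.

(** The squared norm of [C (x k - l)] is a Parseval sum whose terms tend to zero
    and are dominated by multiples of [rn (C (b j)) ^+ 2]. *)
Lemma hilbert_schmidt_weak_cvg (C : {linear H -> H}) (S : R) x l M :
  selfadjoint C -> (forall N, \sum_(j < N) rn (C (b j)) ^+ 2 <= S) ->
  (forall k, rn (x k) <= M) -> weak_cvg x l -> (C \o x) @ U --> C l.
Proof.
move=> Cs CS xM xl.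
have M0 : 0 <= M by apply: le_trans (xM 0%N); exact: rn_ge0.
have xlM k : rn (x k - l) <= 2 * M.
  rewrite (le_trans (rnD _ _))// rnN mulrDl mul1r lerD//.
  exact: weak_cvg_le xl.
pose u j k := hdot (C (x k - l)) (b j) * hdot (b j) (C (x k - l)).
have uE j k : rn (u j k) = rn (hdot (x k - l) (C (b j))) ^+ 2.
  by rewrite /u rnM (hdotC (C _)) rnJ -expr2 Cs.
have h : (fun k => hdot (C (x k - l)) (C (x k - l)) : R[i]^o) @ U --> (0 : R[i]^o).
  apply: (tannery (u := u) (v := fun=> 0) (g := fun j => (2 * M) ^+ 2 * rn (C (b j)) ^+ 2)
     (S := (2 * M) ^+ 2 * S)) => [j k|j|N|j|k|].
  - rewrite uE -exprMn ler_pXn2r ?nnegrE ?mulr_ge0 ?rn_ge0//.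
    by rewrite (le_trans (cauchy_schwarz _ _))// ler_wpM2r ?rn_ge0.
  - by rewrite rn0 mulr_ge0// sqr_ge0.
  - by rewrite -mulr_sumr ler_wpM2l// sqr_ge0.
  - apply/cvg_rnP => e e0; have e1 : 0 < Num.sqrt e by rewrite sqrtr_gt0.
    have /cvg_rnP/(_ _ e1) := xl (C (b j)); apply: filterS => k.
    rewrite -hdotBl subr0 uE => he; rewrite -[ltRHS]sqr_sqrtr ?(ltW e0)//.
    by rewrite ltr_pXn2r ?nnegrE ?rn_ge0 ?sqrtr_ge0.
  - exact: parseval.
  - exact: has_sum0.
apply/cvg_rnP => e e0; have e2 : 0 < e ^+ 2 by rewrite exprn_gt0.
have /cvg_rnP/(_ _ e2) := h; apply: filterS => k.
rewrite subr0 hdotE rn_real ger0_norm ?sqr_ge0// linearB/=.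
by rewrite ltr_pXn2r ?nnegrE ?rn_ge0 ?(ltW e0).
Qed.

Hypothesis Uoo : \oo `<=` U.

Section Maximum.
Variables (C : {linear H -> H}) (S : R).
Hypothesis Cc : continuous C.
Hypothesis Cs : selfadjoint C.
Hypothesis CS : forall N, \sum_(j < N) rn (C (b j)) ^+ 2 <= S.

(** A maximizing sequence has a weak limit, and [C] carries it to a norm limit. *)
Lemma norm_attained (s : seq H) :
  exists x, [/\ forall z, z \in s -> hdot x z = 0, rn x <= 1 &
    forall y, (forall z, z \in s -> hdot y z = 0) -> rn (C y) <= rn (C x) * rn y].
Proof.
pose V x := forall z, z \in s -> hdot x z = 0.
have [M M0 CM] := (continuous_boundedP C).1 Cc.
pose E := [set rn (C x) | x in [set x | V x /\ rn x <= 1]].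
have V0 : V 0 by move=> z _; rewrite hdot0l.
have Esup : has_sup E.
  split; first by exists (rn (C 0)), 0 => //; split=> //; rewrite rn0.
  exists M => _ [x [_ x1] <-]; rewrite (le_trans (CM x))//.
  by rewrite ler_piMr.
have /choice[x xP] k : exists x, [/\ V x, rn x <= 1 & sup E - k.+1%:R^-1 < rn (C x)].
  have [|_ [x [Vx x1] <-] xk] := sup_adherent (_ : 0 < k.+1%:R^-1 :> R) Esup.
    by rewrite invr_gt0.
  by exists x.
have x1 k : rn (x k) <= 1 by have [] := xP k.
have [l xl] := weak_compactness x1.
have Vl : V l.
  move=> z zs; apply: (@limn_unique _ R[i]^o _ U _ _ _ _ (xl z)).
  rewrite (_ : (fun k => hdot (x k) z : R[i]^o) = fun=> 0); first exact: cvg_cst.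
  by apply/funext => k; have [Vx _ _] := xP k; exact: Vx.
have l1 : rn l <= 1 by exact: weak_cvg_le xl.
exists l; split=> // y Vy.
have Cxl := hilbert_schmidt_weak_cvg Cs CS x1 xl.
have supl : sup E <= rn (C l).
  apply/ler_addgt0Pr => e e0; have e2 : 0 < e / 2 by rewrite divr_gt0.
  have ke : U [set k | k.+1%:R^-1 < e / 2].
    apply: Uoo; have := @cvg_harmonic R => /cvgrPdist_lt/(_ _ e2).
    by apply: filterS => k; rewrite sub0r normrN /harmonic/= ger0_norm ?invr_ge0.
  move/cvg_rnP : Cxl => /(_ _ e2) Cxl.
  have [k [kl /= ke']] := filter_ex (filterI Cxl ke).
  have [_ _ /ltW] := xP k; have := rn_subl (C (x k)) (C l).
  move: kl ke'; rewrite /=; move: (k.+1%:R^-1) (rn (C (x k) - C l)) (rn (C (x k))).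
  by move=> d1 d2 d3; lra.
have [y0|y0] := eqVneq (rn y) 0.
  by rewrite (rn0_eq0 y0) linear0 !rn0 mulr0.
have ygt0 : 0 < rn y by rewrite lt_neqAle eq_sym y0 rn_ge0.
have : rn (C ((rn y)^-1%:C *: y)) <= sup E.
  apply: ub_le_sup; first exact: Esup.2.
  exists ((rn y)^-1%:C *: y) => //; split.
    by move=> z zs; rewrite hdotZl Vy// mulr0.
  by rewrite rnZ rn_real ger0_norm ?invr_ge0 ?rn_ge0// mulVf.
rewrite linearZ/= rnZ rn_real ger0_norm ?invr_ge0 ?rn_ge0//.
by rewrite mulrC ler_pdivrMr// => /le_trans; apply; rewrite ler_wpM2r ?rn_ge0.
Qed.

(** At a maximizer [x] of the norm of [C x], with value [M], equality in
    Cauchy-Schwarz gives [C (C x) = M ^ 2 x]; then [C x + M x] or [x] is an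
    eigenvector. *)
Lemma top_eigenvector (s : seq H) :
  (forall z, z \in s -> exists c : R[i], C z = c *: z) ->
  exists (c : R) (e : H), [/\ forall z, z \in s -> hdot e z = 0, C e = c%:C *: e,
    c = 0 -> e = 0, c != 0 -> rn e = 1 &
    forall y, (forall z, z \in s -> hdot y z = 0) -> rn (C y) <= `|c| * rn y].
Proof.
move=> sC; have [x [Vx x1 xmax]] := norm_attained s.
set M := rn (C x) in xmax.
have VC y : (forall z, z \in s -> hdot y z = 0) -> forall z, z \in s -> hdot (C y) z = 0.
  move=> Vy z zs; have [c Cz] := sC _ zs.
  by rewrite Cs Cz hdotZr Vy ?mulr0.
have [M0|M0] := eqVneq M 0.
  exists 0, 0; split=> // [z _|||y Vy]; rewrite ?hdot0l ?linear0 ?scaler0 ?eqxx//.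
  by rewrite normr0 -M0; exact: xmax.
have Mgt0 : 0 < M by rewrite lt_neqAle eq_sym M0 rn_ge0.
have x1' : rn x = 1.
  apply/eqP; rewrite eq_le x1 -(ler_pM2l Mgt0) mulr1; exact: xmax.
have CC : C (C x) = (M ^+ 2)%:C *: x.
  apply/eqP; rewrite -subr_eq0; apply/eqP/rn0_eq0/eqP.
  rewrite -sqrf_eq0 eq_le sqr_ge0 andbT rnBsqr hdotZr conjc_real cReMl Cs Re_hdot.
  rewrite rnZ rn_real ger0_norm ?sqr_ge0// x1' mulr1 -/M.
  have : rn (C (C x)) ^+ 2 <= (M * M) ^+ 2.
    by rewrite ler_pXn2r ?nnegrE ?rn_ge0 ?mulr_ge0 ?(ltW Mgt0)//; exact/xmax/VC.
  set t := rn _ ^+ 2; nra.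
have [h0|h0] := eqVneq (C x + M%:C *: x) 0.
  exists (- M), x; split=> //.
  - by apply/eqP; rewrite realcN scaleNr -addr_eq0 h0.
  - by move=> /eqP; rewrite oppr_eq0 (negbTE M0).
  - by move=> y Vy; rewrite normrN gtr0_norm//; exact: xmax.
set h := C x + _ in h0.
exists M, ((rn h)^-1%:C *: h); split=> //.
- by move=> z zs; rewrite hdotZl hdotDl hdotZl VC// Vx// mulr0 addr0 mulr0.
- rewrite linearZ/= !scalerA mulrC -scalerA; congr (_ *: _).
  by rewrite linearD linearZ/= CC scalerDr scalerA -realcM -expr2 addrC.
- by move=> /eqP; rewrite (negbTE M0).
- by move=> _; exact: rn_normalize.
- by move=> y Vy; rewrite gtr0_norm//; exact: xmax.
Qed.

End Maximum.

(** The last clause says that [`|c n|] is the norm of [C] on the complement of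
    the first [n] eigenvectors.  A finite spectrum is padded with zeros. *)
Definition eigensystem (C : {linear H -> H}) (c : nat -> R) (e : nat -> H) :=
  [/\ orthogonal_family e, forall n, C (e n) = (c n)%:C *: e n,
    forall n, c n = 0 -> e n = 0, forall n, c n != 0 -> rn (e n) = 1 &
    forall n y, (forall k, (k < n)%N -> hdot y (e k) = 0) -> rn (C y) <= `|c n| * rn y].

(** Top eigenvectors are split off one after the other: the complement of
    eigenvectors is invariant under a selfadjoint operator. *)
Lemma hilbert_schmidt_eigensystem (C : {linear H -> H}) (S : R) :
  continuous C -> selfadjoint C -> (forall N, \sum_(j < N) rn (C (b j)) ^+ 2 <= S) ->
  exists c e, eigensystem C c e.
Proof.
move=> Cc Cs CS.
pose Q (s : seq (R * H)%type) (x : (R * H)%type) :=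
  [/\ forall z, z \in map snd s -> hdot x.2 z = 0, C x.2 = x.1%:C *: x.2,
    x.1 = 0 -> x.2 = 0, x.1 != 0 -> rn x.2 = 1 &
    forall y, (forall z, z \in map snd s -> hdot y z = 0) -> rn (C y) <= `|x.1| * rn y].
have [g gQ] : exists g : nat -> (R * H)%type, forall n, Q (mkseq g n) (g n).
  apply: (@recursive_choice _ (0, 0)) => s sP.
  have [|c [e eP]] := top_eigenvector Cc Cs CS (s := map snd s); last by exists (c, e).
  move=> z /(nthP 0)[k]; rewrite size_map => ks <-.
  have [_ Ce _ _ _] := sP k ks; exists (nth (0, 0) s k).1%:C.
  by rewrite (nth_map (0, 0)).
have mem_g n y : (forall k, (k < n)%N -> hdot y (g k).2 = 0) ->
    forall z, z \in map snd (mkseq g n) -> hdot y z = 0.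
  move=> yk z; rewrite /mkseq -map_comp => /mapP[k]; rewrite mem_iota/= => kn ->.
  exact: yk.
have go i j : (j < i)%N -> hdot (g i).2 (g j).2 = 0.
  move=> ji; have [+ _ _ _ _] := gQ i; apply.
  by apply: map_f; apply: map_f; rewrite mem_iota.
exists (fun n => (g n).1), (fun n => (g n).2); split.
- move=> i j; rewrite neq_ltn => /orP[ij|]; last exact: go.
  by rewrite hdotC go ?conjc0.
- by move=> n; have [] := gQ n.
- by move=> n; have [] := gQ n.
- by move=> n; have [] := gQ n.
- by move=> n y yn; have [_ _ _ _] := gQ n; apply; exact: mem_g.
Qed.

End WeakLimits.

Section Eigensystems.
Context {R : realType} {H : hilbertType R}.
Variables (C : {linear H -> H}) (c : nat -> R) (e : nat -> H).
Hypothesis Ce : eigensystem C c e.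

Lemma eigen_orthogonal : orthogonal_family e. Proof. by case: Ce. Qed.

Lemma eigen_le1 n : rn (e n) <= 1.
Proof.
case: Ce => _ _ e0 e1 _; have [/e0 ->|/e1 ->] := eqVneq (c n) 0; last by [].
by rewrite rn0.
Qed.

Lemma eigen_contractive : contractive e.
Proof. exact: orthogonal_contractive eigen_orthogonal eigen_le1. Qed.

Lemma eigen_idem n : hdot (e n) (e n) *: e n = e n.
Proof.
case: Ce => _ _ e0 e1 _; rewrite hdotE.
have [/e0 ->|/e1 ->] := eqVneq (c n) 0; first by rewrite scaler0.
by rewrite expr1n scale1r.
Qed.

(** A vanishing [c m] means that [C] is zero on the complement of the first [m]
    eigenvectors, where the later ones lie. *)
Lemma eigen_initial m n : (m <= n)%N -> c n != 0 -> c m != 0.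
Proof.
case: Ce => eo Cn e0 e1 Cle mn cn0; apply: contra_neq cn0 => cm0.
have [|cn0] := eqVneq (c n) 0; first by [].
have := Cle m (e n); rewrite cm0 normr0 mul0r Cn rnZ rn_real e1// mulr1 => h.
have [mn'|mn'] := eqVneq m n; first by rewrite -mn'.
apply/eqP; rewrite -normr_eq0 eq_le normr_ge0 andbT; apply: h => k km.
by apply: eo; rewrite gtn_eqF// (leq_trans km).
Qed.

Lemma eigen_residual x N k : (k < N)%N ->
  hdot (x - \sum_(n < N) hdot x (e n) *: e n) (e k) = 0.
Proof.
move=> kN; rewrite hdotBl hdot_suml (bigD1 (Ordinal kN))//= big1 ?addr0.
  rewrite hdotZl -[in X in X - _](eigen_idem k) hdotZr hdotE conjc_real.
  by rewrite mulrC subrr.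
by move=> i ik; rewrite hdotZl eigen_orthogonal ?mulr0.
Qed.

Lemma eigen_residual_sqr x N :
  rn x ^+ 2 = rn (x - \sum_(n < N) hdot x (e n) *: e n) ^+ 2
              + rn (\sum_(n < N) hdot x (e n) *: e n) ^+ 2.
Proof.
rewrite -pythagoras ?subrK// hdot_sumr big1// => n _.
by rewrite hdotZr eigen_residual ?mulr0.
Qed.

(** Truncate [x] to its first [N] coordinates: the error has norm at most
    [`|c N| * rn x], and [c] tends to zero because it is summable. *)
Lemma eigen_expansion (T : {linear H -> H}) (w : nat -> H) (S : R) x y :
  (forall N, \sum_(n < N) `|c n| <= S) ->
  (forall z, rn (T z) <= rn (C z)) -> (forall n, T (e n) = (c n)%:C *: w n) ->
  has_sum (fun n => (c n)%:C * hdot x (e n) * hdot (w n) y) (hdot (T x) y).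
Proof.
move=> cS TC Te; apply/has_sumP => eps eps0.
have d0 : 0 < eps / (rn x * rn y + 1).
  by rewrite divr_gt0// ltr_wpDl// mulr_ge0// rn_ge0.
have [N NP] := summable_tail (fun n => normr_ge0 (c n)) cS d0.
exists N => n Nn.
have cn : `|c n| < eps / (rn x * rn y + 1).
  apply: le_lt_trans (NP n.+1).
  by rewrite big_nat_recr//= lerDr sumr_ge0.
set z := x - \sum_(k < n) hdot x (e k) *: e k.
have -> : \sum_(k < n) (c k)%:C * hdot x (e k) * hdot (w k) y - hdot (T x) y = - hdot (T z) y.
  rewrite /z linearB linear_sum/= hdotBl hdot_suml opprB; congr (_ - _).
  by apply: eq_bigr => k _; rewrite linearZ/= Te scalerA hdotZl [_%:C * _]mulrC.
rewrite rnN (le_lt_trans (cauchy_schwarz _ _))//.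
have zx : rn z <= rn x.
  by apply: ler_of_sqr; rewrite ?rn_ge0// (eigen_residual_sqr x n) lerDl sqr_ge0.
have Cz : rn (T z) <= `|c n| * rn x.
  rewrite (le_trans (TC z))//; case: Ce => _ _ _ _ /(_ n z) h.
  rewrite (le_trans (h _))//; last by rewrite ler_wpM2l.
  by move=> k kn; exact: eigen_residual.
rewrite (le_lt_trans (ler_wpM2r (rn_ge0 _) Cz))// -mulrA.
move: cn; rewrite ltr_pdivlMr; last by rewrite ltr_wpDl// mulr_ge0// rn_ge0.
apply: le_lt_trans; rewrite ler_wpM2l// lerDl//.
Qed.

End Eigensystems.

(** * Trace class operators *)

Lemma free_ultrafilter : exists U : set_system nat, UltraFilter U /\ \oo `<=` U.
Proof. exact: ultraFilterLemma. Qed.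

Section TraceClass.
Context {R : realType} {H : hilbertType R}.
Local Notation b := (@onb R H).
Hypothesis bP : orthonormal_basis b.
Implicit Types (T P Q A : {linear H -> H}).

Lemma adj_bound T (M : R) : continuous T -> (forall x, rn (T x) <= M * rn x) ->
  forall x, rn (adjoint T x) <= M * rn x.
Proof.
move=> Tc TM x; have [_ TP] := adjointP bP Tc.
have M0x : 0 <= M * rn x.
  by apply: le_trans (TM x); exact: rn_ge0.
have [->//|Sx0] := eqVneq (rn (adjoint T x)) 0.
have Sx : 0 < rn (adjoint T x) by rewrite lt_neqAle eq_sym Sx0 rn_ge0.
rewrite -(ler_pM2r Sx) -expr2 -Re_hdot -TP (le_trans (leRe _))//.
rewrite (le_trans (cauchy_schwarz _ _))// mulrAC ler_wpM2r ?rn_ge0//.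
Qed.

(** The terms of the trace norm are nonnegative, so its partial sums are below it. *)
Lemma trace_norm_leP T (S : R) : continuous T ->
  (trace_norm T <= S%:E)%E <->
  forall N, \sum_(k < N) complex.Re (hdot (opabs T (b k)) (b k)) <= S.
Proof.
move=> Tc; have [_ Pp _] := opabsP bP Tc.
have t0 k : (0 <= (complex.Re (hdot (opabs T (b k)) (b k)))%:E :> \bar R)%E.
  by rewrite lee_fin; have := Pp (b k); rewrite lecE => /andP[].
have sumE N : (\sum_(0 <= k < N) (complex.Re (hdot (opabs T (b k)) (b k)))%:E =
    (\sum_(k < N) complex.Re (hdot (opabs T (b k)) (b k)))%:E :> \bar R)%E.
  by rewrite sumEFin big_mkord.
split=> [TS N|TS].
  rewrite -lee_fin -sumE; apply: le_trans TS; apply: nneseries_lim_ge => k _ _.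
  exact: t0.
apply: lime_le; first by apply: is_cvg_nneseries => k _ _; exact: t0.
by apply: nearW => N; rewrite sumE lee_fin.
Qed.

Lemma trace_class_bound T : trace_class T -> exists S : R, (trace_norm T <= S%:E)%E.
Proof.
move=> [Tc]; case: (trace_norm T) => [r|//|] _; first by exists r.
by exists 0; rewrite leNye.
Qed.

Lemma opabs_dot T x y : continuous T ->
  hdot (opabs T x) (opabs T y) = hdot (T x) (T y).
Proof.
move=> Tc; have [_ TP] := adjointP bP Tc; have [_ Pp PP] := opabsP bP Tc.
rewrite (positive_selfadjoint Pp x) -/((opabs T \o opabs T) y) PP/=.
by rewrite -TP.
Qed.

(** Cauchy-Schwarz for the form of [P], in the shape
    [0 <= <P (x - t P x), x - t P x>] at [t = 1 / M]. *)
Lemma positive_bound P (M : R) x : positive P -> 0 < M ->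
  (forall x, rn (P x) <= M * rn x) -> rn (P x) ^+ 2 <= M * complex.Re (hdot (P x) x).
Proof.
move=> Pp M0 PM; have Ps := positive_selfadjoint Pp.
have := Pp (x - (M^-1)%:C *: P x); rewrite lecE => /andP[_].
rewrite linearB linearZ/= !hdotBl !hdotBr !hdotZl !hdotZr conjc_real.
rewrite !(cReD, cReN, cReMl) [hdot (P (P x)) x]Ps !Re_hdot.
have : complex.Re (hdot (P (P x)) (P x)) <= M * rn (P x) ^+ 2.
  rewrite (le_trans (leRe _))// (le_trans (cauchy_schwarz _ _))//.
  by rewrite expr2 mulrA ler_wpM2r ?rn_ge0.
set q := rn (P x) ^+ 2; set p := complex.Re (hdot (P x) x).
set r := complex.Re _ => rq.
have Mi0 : 0 < M^-1 by rewrite invr_gt0.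
have : M^-1 * (M^-1 * r) <= M^-1 * q.
  by rewrite ler_wpM2l ?(ltW Mi0)// ler_pdivrMl.
rewrite -(ler_pdivrMl _ _ M0); move: (M^-1 * q) (M^-1 * (M^-1 * r)) => u v.
lra.
Qed.

(** [rn (T x) ^+ 2 = rn (|T| x) ^+ 2] is at most [<|T| x, x>] up to the norm. *)
Lemma trace_norm_hilbert_schmidt T (S : R) : continuous T ->
  (trace_norm T <= S%:E)%E -> exists S', forall N, \sum_(k < N) rn (T (b k)) ^+ 2 <= S'.
Proof.
move=> Tc /(trace_norm_leP _ Tc) TS; have [Pc Pp _] := opabsP bP Tc.
have [M M0 PM] := (continuous_boundedP _).1 Pc.
have M1 : 0 < M + 1 by rewrite ltr_wpDl.
exists ((M + 1) * S) => N; apply: (@le_trans _ _ ((M + 1) *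
    \sum_(k < N) complex.Re (hdot (opabs T (b k)) (b k)))); last first.
  by rewrite ler_wpM2l// ltW.
rewrite mulr_sumr; apply: ler_sum => k _; rewrite -(rn_opabs bP)//.
apply: positive_bound => // x; rewrite (le_trans (PM x))//.
by rewrite ler_wpM2r ?rn_ge0// lerDl.
Qed.

(** [Q] dominates [\sum_(m < M) p m <., e m> e m], because [Q z] is orthogonal to
    [x - z] for the projection [z] of [x] on these eigenvectors.  Sum the
    inequality of the forms over the basis and use Parseval. *)
Lemma eigenvalues_le_trace Q (p : nat -> R) (e : nat -> H) (S : R) M :
  positive Q -> orthogonal_family e -> (forall n, 0 <= p n) ->
  (forall n, Q (e n) = (p n)%:C *: e n) -> (forall n, p n != 0 -> rn (e n) = 1) ->
  (forall N, \sum_(k < N) complex.Re (hdot (Q (b k)) (b k)) <= S) ->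
  \sum_(m < M) p m <= S.
Proof.
move=> Qp eo p0 Qe e1 QS; have Qs := positive_selfadjoint Qp.
have idem n : (p n)%:C * hdot (e n) (e n) = (p n)%:C.
  rewrite hdotE; have [->|/e1 ->] := eqVneq (p n) 0; first by rewrite mul0r.
  by rewrite expr1n mulr1.
have Qx x : \sum_(m < M) p m * rn (hdot x (e m)) ^+ 2 <= complex.Re (hdot (Q x) x).
  pose z := \sum_(m < M) (if p m == 0 then 0 else hdot x (e m)) *: e m.
  have Qz : Q z = \sum_(m < M) ((p m)%:C * hdot x (e m)) *: e m.
    rewrite linear_sum/=; apply: eq_bigr => m _; rewrite linearZ/= Qe scalerA.
    by case: eqP => [->|_]; rewrite ?mul0r// mulrC.
  have Qze k : (k < M)%N -> hdot (Q z) (e k) = (p k)%:C * hdot x (e k).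
    move=> kM; rewrite Qz hdot_suml (bigD1 (Ordinal kM))//= big1 ?addr0.
      by rewrite hdotZl mulrAC idem.
    by move=> i ik; rewrite hdotZl eo ?mulr0.
  have zQ : hdot (Q z) (x - z) = 0.
    rewrite hdotBr [hdot (Q z) z]hdot_sumr {1}Qz hdot_suml -sumrB big1// => m _.
    rewrite hdotZl hdotZr Qze// (hdotC x (e m)).
    by case: eqP => [->|_]; rewrite ?conjc0 ?mul0r ?mulr0 ?subrr// mulrC subrr.
  have -> : hdot (Q x) x = hdot (Q (x - z)) (x - z) + hdot (Q z) z.
    have xE : x = (x - z) + z by rewrite subrK.
    move: (x - z) zQ xE => y zQ ->.
    by rewrite linearD/= hdotDl !hdotDr zQ add0r [hdot (Q y) z]Qs [hdot y _]hdotC zQ conjc0 addr0.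
  have -> : hdot (Q z) z = (\sum_(m < M) p m * rn (hdot x (e m)) ^+ 2)%:C.
    rewrite [hdot (Q z) z]hdot_sumr.
    rewrite (big_morph (fun r : R => r%:C) (fun x y => realcD x y) erefl).
    apply: eq_bigr => m _; rewrite hdotZr Qze//.
    case: eqP => [->|_]; first by rewrite conjc0 !mul0r.
    by rewrite mulrC -mulrA mulcJ realcM.
  rewrite cReD/= lerDr.
  by have := Qp (x - z); rewrite lecE => /andP[].
have hs : has_sum (fun k => \sum_(m < M) (p m)%:C * (hdot (e m) (b k) * hdot (b k) (e m)))
    (\sum_(m < M) (p m)%:C * hdot (e m) (e m)).
  apply: (has_sum_sum (u := fun m k => (p m)%:C * (hdot (e m) (b k) * hdot (b k) (e m)))
    (s := fun m => (p m)%:C * hdot (e m) (e m))) => m.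
  exact: (has_sumZ (a := (p m)%:C) (parseval bP (x := e m) (y := e m))).
have := has_sum_le (g := fun k => \sum_(m < M) p m * rn (hdot (b k) (e m)) ^+ 2) (S := S) _ _ hs.
have -> : \sum_(m < M) (p m)%:C * hdot (e m) (e m) = (\sum_(m < M) p m)%:C.
  rewrite (big_morph (fun r : R => r%:C) (fun x y => realcD x y) erefl).
  by apply: eq_bigr => m _; rewrite idem.
rewrite rn_real ger0_norm ?sumr_ge0//; apply=> [k|N].
  rewrite (le_trans (rn_sum _ _ _))//; apply: ler_sum => m _.
  by rewrite rnM rn_real ger0_norm// rnM hdotC rnJ -expr2.
by apply: le_trans (QS N); apply: ler_sum => k _; exact: Qx.
Qed.

(** The singular value decomposition of a Hilbert-Schmidt operator: [e] are
    eigenvectors of [|T|] and [w n = T (e n) / p n]. *)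
Lemma singular_system T (S : R) : continuous T ->
  (forall N, \sum_(k < N) rn (T (b k)) ^+ 2 <= S) ->
  exists (p : nat -> R) (e w : nat -> H),
    [/\ eigensystem (opabs T) p e, forall n, 0 <= p n, contractive w,
        forall n, T (e n) = (p n)%:C *: w n & forall n, hdot (T (e n)) (w n) = (p n)%:C].
Proof.
move=> Tc TS; have [Pc Pp _] := opabsP bP Tc.
have [U [UU Uoo]] := free_ultrafilter.
have PS N : \sum_(k < N) rn (opabs T (b k)) ^+ 2 <= S.
  by under eq_bigr do rewrite (rn_opabs bP)//.
have [p [e pe]] := hilbert_schmidt_eigensystem UU bP Uoo Pc (positive_selfadjoint Pp) PS.
have [eo Pe e0 e1 _] := pe.
have p0 n : 0 <= p n.
  have [->//|pn0] := eqVneq (p n) 0; have := Pp (e n).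
  by rewrite Pe hdotZl hdotE e1// expr1n mulr1 ler0c.
(* [p n = 0] gives [w n = 0], by the convention [0^-1 = 0] *)
pose w n := (p n)^-1%:C *: T (e n).
have wT n : T (e n) = (p n)%:C *: w n.
  rewrite /w scalerA -realcM; have [pn0|pn0] := eqVneq (p n) 0.
    by rewrite (e0 _ pn0) linear0 scaler0.
  by rewrite mulfV// scale1r.
have dotT m n : hdot (T (e m)) (T (e n)) = (p m * p n)%:C * hdot (e m) (e n).
  by rewrite -opabs_dot// !Pe hdotZl hdotZr conjc_real mulrA realcM.
have Tw n : hdot (T (e n)) (w n) = (p n)%:C.
  rewrite /w hdotZr conjc_real dotT; have [->|pn0] := eqVneq (p n) 0.
    by rewrite mul0r !mul0r mulr0.
  by rewrite hdotE e1// expr1n mulr1 -realcM mulrA mulVf// mul1r.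
exists p, e, w; split=> //; apply: orthogonal_contractive => [m n mn|n].
  by rewrite /w hdotZl hdotZr dotT eo ?mulr0.
have [pn0|pn0] := eqVneq (p n) 0; first by rewrite /w pn0 invr0 scale0r rn0.
suff : rn (w n) ^+ 2 <= 1 by rewrite expr_le1// rn_ge0.
rewrite -Re_hdot {1}/w hdotZl Tw -realcM mulVf//.
Qed.

Lemma schmidt_decomposition T (S : R) : continuous T -> (trace_norm T <= S%:E)%E ->
  exists (p : nat -> R) (e w : nat -> H),
    [/\ forall n, rn (e n) <= 1, forall n, rn (w n) <= 1,
     forall N, \sum_(n < N) `|p n| <= S &
     forall x y, has_sum (fun n => (p n)%:C * hdot x (e n) * hdot (w n) y) (hdot (T x) y)].
Proof.
move=> Tc TS; have [S' TS'] := trace_norm_hilbert_schmidt Tc TS.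
have [_ Pp _] := opabsP bP Tc.
have [p [e [w [pe p0 cw Te _]]]] := singular_system Tc TS'.
have pS N : \sum_(n < N) `|p n| <= S.
  under eq_bigr do rewrite ger0_norm//.
  have [eo Pe _ e1 _] := pe; apply: (eigenvalues_le_trace (Q := opabs T)) eo _ Pe _ _ => //.
  exact/trace_norm_leP.
exists p, e, w; split=> // [n|n|x y]; first exact: eigen_le1 pe n.
  exact: contractive_le1.
by apply: (eigen_expansion pe) pS _ Te => z; rewrite (rn_opabs bP).
Qed.

(** The supremum of these sums is the trace norm; in this form subadditivity
    is immediate. *)
Definition nuclear_bound T (S : R) := forall M (e w : nat -> H),
  contractive e -> contractive w -> rn (\sum_(m < M) hdot (T (e m)) (w m)) <= S.

(** First use the test vectors [b k] and [T (b k) / M] to see that [T] is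
    Hilbert-Schmidt, then its singular vectors to bound the singular values. *)
Lemma nuclear_trace_norm T (S : R) : continuous T -> nuclear_bound T S ->
  (trace_norm T <= S%:E)%E.
Proof.
move=> Tc TS; apply/trace_norm_leP => // K.
have [M M0 TM] : exists2 M : R, 0 < M & forall x, rn (T x) <= M * rn x.
  have [M M0 TM] := (continuous_boundedP T).1 Tc.
  exists (M + 1) => [|x]; first by rewrite ltr_wpDl.
  by rewrite (le_trans (TM x))// ler_wpM2r ?rn_ge0// lerDl.
have cb : contractive b := basis_contractive bP.
have HS N : \sum_(k < N) rn (T (b k)) ^+ 2 <= M * S.
  pose w k := M^-1%:C *: T (b k).
  have cw : contractive w.
    move=> n a; have -> : \sum_(k < n) a k *: w k = M^-1%:C *: T (\sum_(k < n) a k *: b k).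
      rewrite linear_sum scaler_sumr; apply: eq_bigr => k _.
      by rewrite [T (a k *: b k)]linearZ/= /w !scalerA mulrC.
    apply: le_trans (cb n a).
    rewrite ler_pXn2r ?nnegrE ?rn_ge0// rnZ rn_real gtr0_norm ?invr_gt0//.
    by rewrite ler_pdivrMl.
  have : \sum_(k < N) rn (T (b k)) ^+ 2 = M * complex.Re (\sum_(k < N) hdot (T (b k)) (w k)).
    rewrite cRe_sum mulr_sumr; apply: eq_bigr => k _.
    by rewrite hdotZr conjc_real cReMl Re_hdot mulrA mulfV ?mul1r// gt_eqF.
  by move=> ->; rewrite ler_pM2l// (le_trans (leRe _))//; exact: TS.
have [p [e [w [pe p0 cw Te Tew]]]] := singular_system Tc HS.
have ce := eigen_contractive pe.
have pS N : \sum_(n < N) p n <= S.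
  have := TS N e w ce cw; under eq_bigr do rewrite Tew.
  rewrite -(big_morph (fun r : R => r%:C) (fun x y => realcD x y) erefl).
  by rewrite rn_real ger0_norm ?sumr_ge0.
have hs : has_sum (fun n => \sum_(k < K) ((p n)%:C * hdot (b k) (e n) * hdot (e n) (b k)))
    (\sum_(k < K) hdot (opabs T (b k)) (b k)).
  apply: (has_sum_sum (u := fun k n => (p n)%:C * hdot (b k) (e n) * hdot (e n) (b k))
    (s := fun k => hdot (opabs T (b k)) (b k))) => k.
  apply: (eigen_expansion pe (S := S)) => // [N|n]; last by case: pe.
  by under eq_bigr do rewrite ger0_norm//.
rewrite -cRe_sum (le_trans (leRe _))//; apply: has_sum_le pS hs => n.
under eq_bigr do rewrite -mulrA.
rewrite -mulr_sumr rnM rn_real ger0_norm// ler_piMr//.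
rewrite (le_trans (bessel_pair _ _ K cb cb))//.
by rewrite mulr_ile1 ?rn_ge0// (eigen_le1 pe).
Qed.

Lemma trace_has_sum T s : has_sum (fun k => hdot (T (b k)) (b k)) s -> trace T = s.
Proof.
move=> hs; rewrite /trace; apply: cvg_lim; first exact: norm_hausdorff.
rewrite /series /=.
rewrite (_ : (fun n => \sum_(0 <= k < n) (hdot (T (b k)) (b k) : R[i]^o)) =
  (fun n => \sum_(k < n) hdot (T (b k)) (b k) : R[i]^o))//.
by apply/funext => n; rewrite big_mkord.
Qed.

(** The trace of [T A] for [T = \sum_n c n <., v n> u n]: its partial sums are
    [\sum_n c n * (partial Parseval sums of <A (u n), v n>)]. *)
Lemma trace_formula T A (c : nat -> R) (u v : nat -> H) (S M : R) :
  (forall x y, has_sum (fun n => (c n)%:C * hdot x (v n) * hdot (u n) y) (hdot (T x) y)) ->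
  (forall n, rn (u n) <= 1) -> (forall n, rn (v n) <= 1) ->
  (forall N, \sum_(n < N) `|c n| <= S) ->
  continuous A -> (forall x, rn (A x) <= M * rn x) -> 0 <= M ->
  exists s, [/\ has_sum (fun n => (c n)%:C * hdot (A (u n)) (v n)) s,
    has_sum (fun k => hdot (T (A (b k))) (b k)) s & rn s <= S * M].
Proof.
move=> Tuv u1 v1 cS Ac AM M0.
have [_ AP] := adjointP bP Ac; have A'M := adj_bound Ac AM.
have cMS N : \sum_(n < N) `|c n| * M <= S * M by rewrite -mulr_suml ler_wpM2r.
have t1 n : rn ((c n)%:C * hdot (A (u n)) (v n)) <= `|c n| * M.
  rewrite rnM rn_real ler_wpM2l// (le_trans (cauchy_schwarz _ _))//.
  rewrite -[leRHS]mulr1 ler_pM ?rn_ge0// (le_trans (AM _))//.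
  by rewrite -[leRHS]mulr1 ler_wpM2l.
have [s hs] := abs_has_sum t1 cMS.
exists s; split=> //; last exact: has_sum_le t1 cMS hs.
have cb := basis_contractive bP.
pose t n K := (c n)%:C * \sum_(k < K) hdot (A (b k)) (v n) * hdot (u n) (b k).
have tn n K : rn (t n K) <= `|c n| * M.
  rewrite /t rnM rn_real ler_wpM2l//.
  under eq_bigr do rewrite AP.
  rewrite (le_trans (bessel_pair _ _ K cb cb))//.
  rewrite -[leRHS]mulr1 ler_pM ?rn_ge0// (le_trans (A'M _))//.
  by rewrite -[leRHS]mulr1 ler_wpM2l.
rewrite /has_sum; apply: (tannery (u := t) (S := S * M) tn t1 cMS) => [n|K|//].
  have h : has_sum (fun k => hdot (A (b k)) (v n) * hdot (u n) (b k)) (hdot (A (u n)) (v n)).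
    rewrite AP; apply: has_sum_ext (parseval bP (x := u n) (y := adjoint A (v n))) => k.
    by rewrite AP mulrC.
  exact: (@cvgZl_tmp _ R[i]^o _ _ _ (c n)%:C _ _ h).
apply: has_sum_ext (has_sum_sum (M := K)
   (u := fun k n => (c n)%:C * hdot (A (b k)) (v n) * hdot (u n) (b k))
   (s := fun k => hdot (T (A (b k))) (b k)) (fun k => Tuv (A (b k)) (b k))) => n.
by rewrite /t mulr_sumr; apply: eq_bigr => k _; rewrite mulrA.
Qed.

End TraceClass.

(** * Unitary operators *)

Section Unitaries.
Context {R : realType} {H : hilbertType R}.
Implicit Types (U V : {linear H -> H}).

(** The inverse is carried along, so that products of unitaries can be formed
    without computing adjoints. *)
Definition unitary_pair U V := [/\ continuous U, continuous V,
  forall x y, hdot (U x) y = hdot x (V y), cancel U V & cancel V U].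

Lemma unitary_pair_id : unitary_pair idfun idfun.
Proof. by split=> // x; exact: cvg_id. Qed.

Lemma unitary_pair_comp U V U' V' : unitary_pair U V -> unitary_pair U' V' ->
  unitary_pair (U' \o U) (V \o V').
Proof.
move=> [Uc Vc UV UK VK] [U'c V'c U'V' U'K V'K]; split.
- by move=> x; apply: continuous_comp; [exact: Uc|exact: U'c].
- by move=> x; apply: continuous_comp; [exact: V'c|exact: Vc].
- by move=> x y /=; rewrite U'V' UV.
- by move=> x /=; rewrite U'K UK.
- by move=> x /=; rewrite VK V'K.
Qed.

Lemma unitary_pair_dot U V x y : unitary_pair U V -> hdot (U x) (U y) = hdot x y.
Proof. by case=> _ _ UV UK _; rewrite UV UK. Qed.

Lemma unitary_pair_rn U V x : unitary_pair U V -> rn (U x) = rn x.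
Proof.
move=> uv; apply/eqP; rewrite -(@eqrXn2 _ 2) ?rn_ge0//.
by rewrite -!Re_hdot (unitary_pair_dot _ _ uv).
Qed.

Lemma linear_continuous_rank1 (a : R[i]) (w : H) :
  exists2 T : {linear H -> H}, continuous T & forall z, T z = z - (a * hdot z w) *: w.
Proof.
pose f z : H := z - (a * hdot z w) *: w.
have flin : linear f.
  move=> t x y; rewrite /f hdotDZl mulrDr scalerDl opprD addrACA scalerBr.
  by rewrite scalerA mulrCA.
pose T : {linear H -> H} := HB.pack f (GRing.isLinear.Build _ _ _ _ f flin).
exists T => //; apply/continuous_boundedP; exists (1 + rn a * rn w * rn w) => [|z].
  by rewrite addr_ge0// !mulr_ge0// rn_ge0.
rewrite (le_trans (rnD _ _))// rnN mulrDl mul1r lerD2l// rnZ rnM.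
rewrite -!mulrA ler_wpM2l ?rn_ge0// [leRHS]mulrC ler_wpM2r ?rn_ge0// [leRHS]mulrC.
exact: cauchy_schwarz.
Qed.

(** The complex reflection [z |-> z - (<z, w> / <x, w>) w] along [w = x - y];
    it is unitary since [<w, w> = <x, w> + <w, x>]. *)
Lemma reflection x y : rn x = rn y -> exists U V,
  [/\ unitary_pair U V, U x = y & forall z, hdot z (x - y) = 0 -> U z = z].
Proof.
move=> xy; have [->|xny] := eqVneq x y.
  by exists idfun, idfun; split=> //; exact: unitary_pair_id.
have [w wxy] : exists w, w = x - y by exists (x - y).
rewrite -wxy; set d := hdot x w.
have wE : hdot w w = d + d^*%C.
  rewrite /d -hdotC {1}wxy hdotBl; congr (_ + _); apply/eqP.
  rewrite -subr_eq0 -opprD oppr_eq0 wxy hdotBl hdotBr [hdot x x]hdotE xy -hdotE.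
  by rewrite addrC addrA subrK subrr.
have d0 : d != 0.
  apply: contra_neq xny => d0; apply/eqP; rewrite -subr_eq0; apply/eqP/hdot_eq0.
  by rewrite -wxy wE d0 conjc0 addr0.
have dJ0 : d^*%C != 0 by rewrite conjc_eq0.
have [U Uc UE] := linear_continuous_rank1 d^-1 w.
have [V Vc VE] := linear_continuous_rank1 (d^*%C)^-1 w.
exists U, V; split.
- split=> // [z t|z|z].
  + rewrite UE VE hdotBl hdotBr hdotZl hdotZr conjcM conjc_inv conjcK -hdotC.
    by congr (_ - _); rewrite mulrAC.
  + rewrite VE UE hdotBl hdotZl wE.
    have -> : (d^*%C)^-1 * (hdot z w - d^-1 * hdot z w * (d + d^*%C)) = - (d^-1 * hdot z w).
      by field; apply/andP.
    by rewrite scaleNr opprK subrK.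
  + rewrite UE VE hdotBl hdotZl wE.
    have -> : d^-1 * (hdot z w - (d^*%C)^-1 * hdot z w * (d + d^*%C)) = - ((d^*%C)^-1 * hdot z w).
      by field; apply/andP.
    by rewrite scaleNr opprK subrK.
- by rewrite UE -/d mulVf// scale1r wxy opprB addrC subrK.
- by move=> z zw; rewrite UE zw mulr0 scale0r subr0.
Qed.

(** Each new vector is put in place by a reflection, which fixes the earlier ones
    because they are orthogonal to the difference. *)
Lemma unitary_extension N (e h : nat -> H) :
  (forall n m, (n < N)%N -> (m < N)%N -> hdot (e n) (e m) = hdot (h n) (h m)) ->
  exists U V, unitary_pair U V /\ forall n, (n < N)%N -> U (e n) = h n.
Proof.
elim: N => [|N IH] eh; first by exists idfun, idfun; split=> //; exact: unitary_pair_id.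
have [U [V [UV Ue]]] := IH (fun n m nN mN => eh n m (ltnW nN) (ltnW mN)).
have xy : rn (U (e N)) = rn (h N).
  rewrite (unitary_pair_rn _ UV); apply/eqP; rewrite -(@eqrXn2 _ 2) ?rn_ge0//.
  by rewrite -!Re_hdot eh.
have [U' [V' [U'V' U'e U'z]]] := reflection xy.
exists (U' \o U), (V \o V'); split; first exact: unitary_pair_comp.
move=> n; rewrite ltnS leq_eqVlt => /orP[/eqP ->//|nN]; rewrite /= Ue// U'z//.
by rewrite hdotBr -{1}Ue// (unitary_pair_dot _ _ UV) eh ?subrr// (ltn_trans nN).
Qed.

Variable b : nat -> H.
Hypothesis bP : orthonormal_basis b.

Lemma unitary_pair_unitary U V : unitary_pair U V -> unitary U /\ adjoint U =1 V.
Proof.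
move=> [Uc Vc UV UK VK]; have [_ UP] := adjointP bP Uc.
have adjE : adjoint U =1 V.
  move=> x; apply: hdot_ext => z; rewrite hdotC -UP UV -hdotC//.
by split=> //; split=> // x /=; rewrite adjE.
Qed.

Lemma unitary_unitary_pair U : unitary U -> unitary_pair U (adjoint U).
Proof.
by move=> [Uc UK VK]; have [Vc UV] := adjointP bP Uc; split.
Qed.

End Unitaries.

(** * Diagonal operators and their unitary orbits *)

Section Orbits.
Context {R : realType} {H : hilbertType R}.
Local Notation b := (@onb R H).
Hypothesis bP : orthonormal_basis b.
Implicit Types (T X Y A : {linear H -> H}).

(** [T = \sum_n c n <., h n> h n] in the weak sense. *)
Definition diagonal_op T (c : nat -> R) (h : nat -> H) := forall x y,
  has_sum (fun n => (c n)%:C * hdot x (h n) * hdot (h n) y) (hdot (T x) y).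

Lemma diagonal_exists (c : nat -> R) (h : nat -> H) (S : R) :
  (forall N, \sum_(n < N) `|c n| <= S) -> (forall n, rn (h n) <= 1) ->
  exists2 X : {linear H -> H}, continuous X & diagonal_op X c h.
Proof.
move=> cS h1.
have tM x y n : rn ((c n)%:C * hdot x (h n) * hdot (h n) y) <= `|c n| * (rn x * rn y).
  rewrite !rnM rn_real -mulrA ler_wpM2l// ler_pM ?rn_ge0//.
    by rewrite (le_trans (cauchy_schwarz _ _))// ler_piMr ?rn_ge0.
  by rewrite (le_trans (cauchy_schwarz _ _))// ler_piMl ?rn_ge0.
have cSM (x y : H) N : \sum_(n < N) `|c n| * (rn x * rn y) <= S * (rn x * rn y).
  by rewrite -mulr_suml ler_wpM2r// mulr_ge0// rn_ge0.
have /choice[B BP] (p : H * H) : exists s,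
    has_sum (fun n => (c n)%:C * hdot p.1 (h n) * hdot (h n) p.2) s.
  exact: abs_has_sum (tM p.1 p.2) (cSM p.1 p.2).
have [|||X Xc XB] := form_operator bP (B := fun x y => B (x, y)) (M := S).
- move=> a x y z; apply: has_sum_unique (BP (_, _)) _.
  apply: has_sum_ext (has_sumD (has_sumZ (a := a) (BP (x, z))) (BP (y, z))) => n /=.
  by rewrite hdotDZl; ring.
- move=> a x y z; apply: has_sum_unique (BP (_, _)) _.
  apply: has_sum_ext (has_sumD (has_sumZ (a := a^*%C) (BP (z, x))) (BP (z, y))) => n /=.
  by rewrite hdotDr hdotZr; ring.
- by move=> x y; exact: has_sum_le (tM x y) (cSM x y) (BP (x, y)).
by exists X => // x y; rewrite XB; exact: BP (x, y).
Qed.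

(** By Bessel the term of index [n] contributes at most [`|c n|] for each of the
    two families; allowing two of them covers differences of operators. *)
Lemma diagonal_nuclear_bound T (c : nat -> R) (h h' : nat -> H) (S : R) :
  (forall N, \sum_(n < N) `|c n| <= S) ->
  (forall n, rn (h n) <= 1) -> (forall n, rn (h' n) <= 1) ->
  (forall x y, has_sum (fun n => (c n)%:C * hdot x (h n) * hdot (h n) y
     - (c n)%:C * hdot x (h' n) * hdot (h' n) y) (hdot (T x) y)) ->
  nuclear_bound T (2 * S).
Proof.
move=> cS h1 h'1 Th M e w ce cw.
have hs : has_sum (fun n => \sum_(m < M) ((c n)%:C * hdot (e m) (h n) * hdot (h n) (w m)
     - (c n)%:C * hdot (e m) (h' n) * hdot (h' n) (w m))) (\sum_(m < M) hdot (T (e m)) (w m)).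
  exact: (has_sum_sum (u := fun m n => (c n)%:C * hdot (e m) (h n) * hdot (h n) (w m)
     - (c n)%:C * hdot (e m) (h' n) * hdot (h' n) (w m))
     (s := fun m => hdot (T (e m)) (w m)) (fun m => Th (e m) (w m))).
have bp x : rn x <= 1 -> rn (\sum_(m < M) hdot (e m) x * hdot x (w m)) <= 1.
  move=> x1; rewrite (le_trans (bessel_pair _ _ M ce cw))//.
  by rewrite mulr_ile1 ?rn_ge0.
apply: (has_sum_le (g := fun n => 2 * `|c n|)) hs => [n|N]; last first.
  by rewrite -mulr_sumr ler_wpM2l.
rewrite sumrB; under eq_bigr do rewrite -mulrA.
rewrite -mulr_sumr; under [X in _ - X]eq_bigr do rewrite -mulrA.
rewrite -mulr_sumr -mulrBr rnM rn_real mulrC ler_wpM2r//.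
rewrite (le_trans (rnD _ _))// rnN -[leRHS]/(1 + 1) lerD// ?bp//.
Qed.

Variables (C : {linear H -> H}) (c : nat -> R) (e : nat -> H) (S : R).
Hypothesis Cc : continuous C.
Hypothesis cS : forall N, \sum_(n < N) `|c n| <= S.
Hypothesis e1 : forall n, rn (e n) <= 1.
Hypothesis Ce : diagonal_op C c e.

Lemma unitary_orbit_diagonal U V : unitary_pair U V ->
  exists Y, [/\ unitary_orbit C Y, continuous Y & diagonal_op Y c (U \o e)].
Proof.
move=> UV; have [Uu adjE] := unitary_pair_unitary bP UV.
have [Uc Vc UVd _ _] := UV; have [Ac UA] := adjointP bP Uc.
exists (U \o C \o adjoint U); split.
- by exists U.
- move=> x; apply: continuous_comp; first exact: Ac.
  by apply: continuous_comp; [exact: Cc|exact: Uc].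
- move=> x y; rewrite /= UVd adjE; apply: has_sum_ext (Ce (x := V x) (y := V y)) => n.
  by rewrite !UVd (hdotC (e n) (V x)) -UVd -hdotC.
Qed.

Lemma unitary_orbitP Y : unitary_orbit C Y -> exists U V,
  [/\ unitary_pair U V, continuous Y & diagonal_op Y c (U \o e)].
Proof.
move=> [U Uu <-]; have UV := unitary_unitary_pair bP Uu.
exists U, (adjoint U); have [Uc Ac UVd _ _] := UV; split; first exact: UV.
  move=> x; apply: continuous_comp; first exact: Ac.
  by apply: continuous_comp; [exact: Cc|exact: Uc].
move=> x y; rewrite /= UVd; apply: has_sum_ext (Ce (x := adjoint U x) (y := adjoint U y)) => n.
by rewrite !UVd (hdotC (e n) (adjoint U x)) -UVd -hdotC.
Qed.

Lemma continuousB X Y : continuous X -> continuous Y -> continuous (X \- Y).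
Proof. by move=> Xc Yc x; apply: cvgB; [exact: Xc|exact: Yc]. Qed.

(** A unitary moves finitely many of the [e n] exactly to the [h n]; what remains
    is a tail of [c], small in trace norm. *)
Lemma orbit_closure_diagonal X (h : nat -> H) : continuous X -> diagonal_op X c h ->
  (forall n m, hdot (h n) (h m) = hdot (e n) (e m)) -> orbit_closure C X.
Proof.
move=> Xc Xh he.
have h1 n : rn (h n) <= 1.
  suff -> : rn (h n) = rn (e n) by [].
  apply/eqP; rewrite -(@eqrXn2 _ 2) ?rn_ge0//.
  by rewrite -!Re_hdot he.
split.
  split=> //; apply: (@le_lt_trans _ _ (2 * S)%:E); last exact: ltry.
  apply: (nuclear_trace_norm bP) => //.
  apply: (diagonal_nuclear_bound cS h1 (h' := fun=> 0)) => [n|x y].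
    by rewrite rn0.
  by apply: has_sum_ext (Xh x y) => n; rewrite hdot0r mulr0 mul0r subr0.
move=> eps eps0; have eps4 : 0 < eps / 4 by rewrite divr_gt0.
have [N NP] := summable_tail (fun n => normr_ge0 (c n)) cS eps4.
have [U [V [UV Ue]]] := @unitary_extension _ _ N e h (fun n m _ _ => esym (he n m)).
have [Y [Yorb Yc Yd]] := unitary_orbit_diagonal UV.
exists Y => //; apply: (@le_lt_trans _ _ (2 * (eps / 4))%:E); last first.
  by rewrite lte_fin; lra.
apply: (nuclear_trace_norm bP); first exact: continuousB.
apply: (diagonal_nuclear_bound (c := fun n => if (n < N)%N then 0 else c n)
   (h := h) (h' := U \o e)) => [n|n|n|x y]; first last.
- rewrite [hdot _ y]hdotBl.
  apply: has_sum_ext (has_sumB (Xh x y) (Yd x y)) => n /=.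
  by case: ltnP => [nN|//]; rewrite Ue// !subrr.
- by rewrite /= (unitary_pair_rn _ UV).
- exact: h1.
- apply: ltW; apply: le_lt_trans (NP n).
  rewrite -(big_mkord xpredT (fun k => `|if (k < N)%N then 0 else c k|)).
  have [nN|Nn] := leqP n N.
    rewrite big_nat big1 ?sumr_ge0// => k /andP[_ kn].
    by rewrite (leq_trans kn nN) normr0.
  rewrite (@big_cat_nat _ _ _ N 0 n)//= ?(ltnW Nn)// big_nat big1 ?add0r; last first.
    by move=> k /andP[_ ->]; rewrite normr0.
  rewrite big_nat [leRHS]big_nat; apply: ler_sum => k /andP[Nk _].
  by rewrite ltnNge Nk.
Qed.

(** The difference [X - Y] has a Schmidt decomposition with coefficients of sum
    at most its trace norm, so the trace formula bounds the trace of
    [(X - Y) A]. *)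
Lemma orbit_closure_trace X A (eps : R) : orbit_closure C X -> continuous A -> 0 < eps ->
  exists U V s, [/\ unitary_pair U V,
    has_sum (fun n => (c n)%:C * hdot (A (U (e n))) (U (e n))) s &
    rn (trace (X \o A) - s : R[i]) < eps].
Proof.
move=> [[Xc _] Xorb] Ac eps0.
have [M M0 AM] := (continuous_boundedP A).1 Ac.
have d0 : 0 < eps / (M + 1) by rewrite divr_gt0// ltr_wpDl.
have [Y Yorb XY] := Xorb _ d0.
have [U [V [UV Yc Yd]]] := unitary_orbitP Yorb.
have Ue1 n : rn ((U \o e) n) <= 1 by rewrite /= (unitary_pair_rn _ UV).
have [s [hs hsY _]] := trace_formula bP Yd Ue1 Ue1 cS Ac AM M0.
have [p [f [w [f1 w1 pS TX]]]] := schmidt_decomposition bP (continuousB Xc Yc) (ltW XY).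
have [t [_ hsXY tM]] := trace_formula bP TX w1 f1 pS Ac AM M0.
exists U, V, s; split=> //.
(* [t] is the trace of [(X - Y) A] and [s] that of [Y A] *)
have -> : trace (X \o A) = t + s :> R[i].
  apply: trace_has_sum; apply: has_sum_ext (has_sumD hsXY hsY) => k.
  by rewrite [hdot (_ - _) _]hdotBl subrK.
rewrite addrK (le_lt_trans tM)// mulrAC ltr_pdivrMr ?ltr_wpDl//.
by rewrite ltr_pM2l// ltrDl.
Qed.

End Orbits.

(** * Dimension and dilation of contractive families *)

Section Dimension.
Context {R : realType} {H : hilbertType R}.
Implicit Types (V : set H).

Definition independent_in V n := exists v : 'I_n -> H, (forall i, V (v i)) /\ lin_indep v.

Lemma hdim_ge V n : independent_in V n -> (n%:R%:E <= hdim V)%E.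
Proof. by move=> Vn; apply: ereal_sup_ubound; exists n. Qed.

(** The dimensions of independent families are integers, so a supremum of at
    least [n] is witnessed. *)
Lemma independent_in_hdim V n : (n%:R%:E <= hdim V)%E -> exists2 m, (n <= m)%N & independent_in V m.
Proof.
case: n => [_|n nV].
  by exists 0%N => //; exists (fun=> 0); split=> [[]//|a _ []//].
apply: contrapT => noV; have : (hdim V <= n%:R%:E)%E.
  apply: ge_ereal_sup => _ [m Vm <-]; rewrite lee_fin ler_nat leqNgt.
  by apply/negP => nm; apply: noV; exists m.
by move=> /(le_trans nV); rewrite lee_fin ler_nat ltnn.
Qed.

(** More unknowns than equations: the orthogonality conditions on a combination
    of the independent vectors have a nonzero solution. *)
Lemma unit_orthogonal V (s : seq H) n :
  (forall a x y, V x -> V y -> V (a *: x + y)) -> V 0 ->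
  independent_in V n -> (size s < n)%N ->
  exists u, [/\ V u, rn u = 1 & forall z, z \in s -> hdot u z = 0].
Proof.
move=> Vl V0 [v [Vv vi]] sn.
pose M : 'M[R[i]]_(n, size s) := \matrix_(i, j) hdot (v i) (nth 0 s j).
have /rowV0Pn[a /sub_kermxP aM a0] : kermx M != 0.
  apply: contraTneq sn => kM; rewrite -leqNgt.
  have : row_free M by rewrite -kermx_eq0 kM.
  by rewrite /row_free => /eqP <-; exact: rank_leq_col.
pose y := \sum_i a 0 i *: v i.
have y0 : y != 0.
  apply: contra_neq a0 => y0; apply/rowP => i; rewrite mxE.
  exact: (vi (fun i => a 0 i)).
have Vsum (F : 'I_n -> R[i]) (r : seq 'I_n) : V (\sum_(i <- r) F i *: v i).
  elim: r => [|i r IH]; first by rewrite big_nil.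
  by rewrite big_cons; apply: Vl.
exists ((rn y)^-1%:C *: y); split; last 1 first.
- move=> z /(nthP 0)[j js <-]; rewrite hdotZl hdot_suml.
  have := congr1 (fun B : 'rV[R[i]]_(size s) => B 0 (Ordinal js)) aM.
  rewrite !mxE => h; rewrite (eq_bigr (fun i => a 0 i * M i (Ordinal js))) ?h ?mulr0//.
  by move=> i _; rewrite hdotZl mxE.
- by rewrite -[_ *: y]addr0; apply: Vl => //; exact: Vsum.
- exact: rn_normalize.
Qed.

End Dimension.

Section Dilation.
Context {R : realType} {H K : hilbertType R}.
Implicit Types (f : nat -> H) (g : nat -> K).

(** The Gram matrices of [f] and [g] add up to the identity. *)
Lemma gram_sum_sqr f g n (a : nat -> R[i]) :
  (forall i j, (i < n)%N -> (j < n)%N -> hdot (g i) (g j) = (i == j)%:R - hdot (f i) (f j)) ->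
  rn (\sum_(i < n) a i *: g i) ^+ 2 + rn (\sum_(i < n) a i *: f i) ^+ 2 =
  \sum_(i < n) rn (a i) ^+ 2.
Proof.
move=> gf; rewrite -!Re_hdot -cReD !hdot_suml -big_split/=.
rewrite cRe_sum; apply: eq_bigr => i _.
rewrite !hdotZl -mulrDr !hdot_sumr -big_split/=.
rewrite (bigD1 i)//= big1 ?addr0 => [|j ji]; last first.
  rewrite !hdotZr -mulrDr gf// subrK [_ == _](_ : _ = false) ?mulr0//.
  by apply/negbTE; rewrite eq_sym.
by rewrite !hdotZr -mulrDr gf// subrK eqxx mulr1 mulcJ.
Qed.

Lemma contractive_extend f n (a : nat -> R[i]) (t : R[i]) : contractive f ->
  rn (\sum_(i < n) a i *: f i + t *: f n) ^+ 2 <= \sum_(i < n) rn (a i) ^+ 2 + rn t ^+ 2.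
Proof.
move=> cf; have := cf n.+1 (fun i => if (i < n)%N then a i else t).
rewrite !big_ord_recr/= ltnn.
by congr (rn (_ + _) ^+ 2 <= _ + _); apply: eq_bigr => i _; rewrite ltn_ord.
Qed.

(** A combination of [g 0], ..., [g n.-1] with the prescribed scalar products
    [- <f n, f i>] is a solution of [alpha *m G = beta], with [G] the Gram
    matrix of [g].  It is solvable because a null vector [xi] of [G] is a
    direction in which [f] preserves norms, and contractivity makes [f n]
    orthogonal to it. *)
Lemma dilation_step f g n : contractive f ->
  (forall i j, (i < n)%N -> (j < n)%N -> hdot (g i) (g j) = (i == j)%:R - hdot (f i) (f j)) ->
  exists a : nat -> R[i],
    (forall i, (i < n)%N -> hdot (\sum_(k < n) a k *: g k) (g i) = - hdot (f n) (f i)) /\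
    rn (\sum_(k < n) a k *: g k) ^+ 2 + rn (f n) ^+ 2 <= 1.
Proof.
move=> cf gf.
pose G : 'M[R[i]]_n := \matrix_(j, i) hdot (g j) (g i).
pose beta : 'rV[R[i]]_n := \row_i (- hdot (f n) (f i)).
pose coef (x : 'I_n -> R[i]) (k : nat) := if insub k is Some i then x i else 0.
have coefE x (i : 'I_n) : coef x i = x i by rewrite /coef valK.
have /submxP[alpha alphaG] : (beta <= G)%MS.
  rewrite submxE; apply/eqP/matrixP => i0 col; rewrite [LHS]mxE [RHS]mxE.
  pose xi k := coef (fun i => (cokermx G i col)^*%C) k.
  pose q := \sum_(k < n) xi k *: g k.
  pose F := \sum_(k < n) xi k *: f k.
  have gq j : (j < n)%N -> hdot (g j) q = 0.
    move=> jn; rewrite hdot_sumr.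
    have h : (G *m cokermx G) (Ordinal jn) col = 0 by rewrite mulmx_coker mxE.
    rewrite mxE in h; rewrite -[RHS]h; apply: eq_bigr => i _.
    by rewrite hdotZr /xi coefE conjcK mulrC [G _ _]mxE.
  have q0 : q = 0.
    by apply: hdot_eq0; rewrite hdot_suml big1// => j _; rewrite hdotZl gq ?mulr0.
  have FE : rn F ^+ 2 = \sum_(k < n) rn (xi k) ^+ 2.
    by rewrite -(gram_sum_sqr xi gf) -/q q0 rn0 expr0n add0r.
  pose t := hdot F (f n).
  have t0 : t = 0.
    (* contractivity at [F + t f n] gives [2 |t| ^ 2 <= |t| ^ 2] *)
    have := contractive_extend n xi t cf; rewrite -/F rnDsqr hdotZr FE.
    rewrite -/t [t^*%C * t]mulrC mulcJ/= -addrA lerD2l => h.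
    apply: rn0_eq0; apply/eqP; rewrite -sqrf_eq0 eq_le sqr_ge0 andbT.
    by have := sqr_ge0 (rn (t *: f n)); lra.
  have : hdot (f n) F = 0 by rewrite hdotC -/t t0 conjc0.
  rewrite hdot_sumr => h; transitivity (- \sum_(k < n) hdot (f n) (xi k *: f k)).
    rewrite -sumrN; apply: eq_bigr => i _.
    by rewrite [beta _ _]mxE hdotZr /xi coefE conjcK mulrC mulrN.
  by rewrite h oppr0.
pose a k := coef (fun i => alpha 0 i) k; exists a.
set g' := \sum_(k < n) _.
have g'g i : (i < n)%N -> hdot g' (g i) = - hdot (f n) (f i).
  move=> iN; have := congr1 (fun B : 'rV[R[i]]_n => B 0 (Ordinal iN)) alphaG.
  rewrite [beta _ _]mxE mxE => ->; rewrite hdot_suml; apply: eq_bigr => k _.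
  by rewrite hdotZl /a coefE [G _ _]mxE.
split=> //.
pose F := \sum_(k < n) a k *: f k.
have g'F : complex.Re (hdot F (f n)) = - rn g' ^+ 2.
  rewrite hdotC cReJ -Re_hdot -cReN {2}/g' !hdot_sumr -sumrN; congr complex.Re.
  by apply: eq_bigr => k _; rewrite !hdotZr g'g// mulrN opprK.
(* contractivity at [F - f n] *)
have := contractive_extend n a (- 1) cf; rewrite -/F scaleN1r rnBsqr g'F.
by rewrite -(gram_sum_sqr a gf) -/g' -/F rnN rn1; lra.
Qed.

(** The vectors [g n] are chosen one after the other: the step above prescribes
    the scalar products, and a unit vector of [V] orthogonal to the earlier ones
    brings the norm to the right value. *)
Lemma dilation f (D : pred nat) (V : set K) : contractive f ->
  (forall m n, (m <= n)%N -> D n -> D m) ->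
  (forall a x y, V x -> V y -> V (a *: x + y)) -> V 0 ->
  (forall n, D n -> forall s : seq K, size s = n ->
     exists u, [/\ V u, rn u = 1 & forall z, z \in s -> hdot u z = 0]) ->
  exists g, [/\ forall n, V (g n), forall n, ~~ D n -> g n = 0 &
    forall m n, D m -> D n -> hdot (g m) (g n) = (m == n)%:R - hdot (f m) (f n)].
Proof.
move=> cf Di Vl V0 room.
pose Q (s : seq K) (x : K) := [/\ V x, ~~ D (size s) -> x = 0 & D (size s) ->
  (forall k, (k < size s)%N -> hdot x (nth 0 s k) = - hdot (f (size s)) (f k)) /\
  rn x ^+ 2 + rn (f (size s)) ^+ 2 = 1].
have [g gQ] : exists g : nat -> K, forall n, Q (mkseq g n) (g n).
  apply: (@recursive_choice _ 0) => s sP; set N := size s in sP *.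
  have [DN|DN] := boolP (D N); last by exists 0; split=> // DN'; rewrite DN' in DN.
  have sQ i : (i < N)%N -> [/\ V (nth 0 s i),
      forall k, (k < i)%N -> hdot (nth 0 s i) (nth 0 s k) = - hdot (f i) (f k)
      & rn (nth 0 s i) ^+ 2 + rn (f i) ^+ 2 = 1].
    move=> iN; have [Vi _ +] := sP _ iN.
    rewrite (size_takel (ltnW iN)) => /(_ (Di _ _ (ltnW iN) DN)) [h1 h2]; split=> // k ki.
    by have := h1 k ki; rewrite nth_take.
  have gram i j : (i < N)%N -> (j < N)%N ->
      hdot (nth 0 s i) (nth 0 s j) = (i == j)%:R - hdot (f i) (f j).
    move=> iN jN; have [ij|ji|ij] := ltngtP i j.
    - have [_ h _] := sQ j jN; rewrite hdotC h// conjcN -hdotC sub0r//.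
    - by have [_ -> //] := sQ i iN; rewrite sub0r.
    - rewrite -ij !hdotE; have [_ _ h] := sQ i iN.
      by rewrite -[1%:R]/(1%:C) -h realcD addrK.
  have [a [ag a1]] := dilation_step cf gram.
  set g' := \sum_(k < N) _ in ag a1.
  have [u [Vu u1 us]] := room N DN s erefl.
  (* the norm that [g'] still lacks is supplied in the direction [u] *)
  pose t := Num.sqrt (1 - rn (f N) ^+ 2 - rn g' ^+ 2).
  have t2 : t ^+ 2 = 1 - rn (f N) ^+ 2 - rn g' ^+ 2 by rewrite sqr_sqrtr//; lra.
  have g'u : hdot g' (t%:C *: u) = 0.
    rewrite hdot_suml big1// => k _; rewrite hdotZl hdotZr hdotC us ?conjc0 ?mulr0//.
    exact: mem_nth.
  exists (t%:C *: u + g'); split=> [||_]; last split.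
  - apply: (Vl) => //; rewrite /g'.
    have Vsum (r : seq 'I_N) : V (\sum_(k <- r) a k *: nth 0 s k).
      elim: r => [|k r IH]; first by rewrite big_nil.
      by rewrite big_cons; apply: Vl => //; have [] := sQ k (ltn_ord k).
    exact: Vsum.
  - by rewrite -/N DN.
  - by move=> k kN; rewrite hdotDl hdotZl us ?mem_nth// mulr0 add0r ag.
  - rewrite [_ *: u + _]addrC pythagoras// rnZ u1 mulr1 rn_real real_normK ?num_real// t2.
    by rewrite -/N; lra.
exists g; split=> [n|n Dn|].
- by have [] := gQ n.
- by have [_ + _] := gQ n; rewrite size_mkseq; exact.
have lower m n : (n < m)%N -> D m -> hdot (g m) (g n) = - hdot (f m) (f n).
  move=> nm Dm; have [_ _] := gQ m; rewrite size_mkseq => /(_ Dm)[/(_ n nm) + _].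
  by rewrite nth_mkseq.
move=> m n Dm Dn; have [mn|nm|mn] := ltngtP m n.
- by rewrite hdotC lower// conjcN -hdotC sub0r.
- by rewrite lower// sub0r.
- rewrite -mn !hdotE; have [_ _] := gQ m; rewrite size_mkseq => /(_ Dm)[_ h].
  by rewrite -[1%:R]/(1%:C) -h realcD addrK.
Qed.

End Dilation.

(** * Values on contractive families *)

Section Values.
Context {R : realType} {H : hilbertType R}.
Local Notation b := (@onb R H).
Hypothesis bP : orthonormal_basis b.
Variable A : {linear H -> H}.
Hypothesis Ac : continuous A.
Variables (c : nat -> R) (S : R).
Hypothesis cS : forall N, \sum_(n < N) `|c n| <= S.

(** The values [\sum_n c n <A f_n, f_n>], with the orthonormal families that
    give the elements of the orbit relaxed to contractive ones. *)
Definition contractive_values : set R[i]^o :=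
  [set s | exists2 f, contractive f & has_sum (fun n => (c n)%:C * hdot (A (f n)) (f n)) s].

Lemma contractive_value_exists (f : nat -> H) : (forall n, rn (f n) <= 1) ->
  exists s, has_sum (fun n => (c n)%:C * hdot (A (f n)) (f n)) s.
Proof.
move=> f1; have [M M0 AM] := (continuous_boundedP A).1 Ac.
apply: (abs_has_sum (g := fun n => `|c n| * M) (S := S * M)) => [n|N].
  rewrite rnM rn_real ler_wpM2l// (le_trans (cauchy_schwarz _ _))//.
  rewrite -[leRHS]mulr1 ler_pM ?rn_ge0// (le_trans (AM _))//.
  by rewrite -[leRHS]mulr1 ler_wpM2l.
by rewrite -mulr_suml ler_wpM2r.
Qed.

(** Terms with [c n = 0] do not contribute. *)
Lemma contractive_values_restrict s : contractive_values s ->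
  exists f, [/\ contractive f, forall n, c n = 0 -> f n = 0 &
    has_sum (fun n => (c n)%:C * hdot (A (f n)) (f n)) s].
Proof.
move=> [f cf fs]; exists (fun n => if c n == 0 then 0 else f n); split.
- move=> N a; have := cf N (fun n => if c n == 0 then 0 else a n).
  rewrite (eq_bigr (fun n : 'I_N => a n *: (if c n == 0 then 0 else f n))); last first.
    by move=> n _; case: ifP; rewrite ?scaler0 ?scale0r.
  move=> /le_trans; apply; apply: ler_sum => n _; case: ifP => // _.
  by rewrite rn0 expr0n sqr_ge0.
- by move=> n ->; rewrite eqxx.
- by apply: has_sum_ext fs => n; case: eqP => // ->; rewrite !mul0r.
Qed.

Lemma closure_rnP (E : set R[i]^o) (s : R[i]^o) :
  closure E s <-> forall eps : R, 0 < eps -> exists2 t, E t & rn (t - s : R[i]) < eps.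
Proof.
split=> [Es eps eps0|Es B].
  have [|t [Et /=]] := Es (ball s eps%:C).
    by apply: nbhsx_ballx; rewrite ltcR.
  by rewrite -ball_normE/= rnE ltcR => ts; exists t => //; rewrite rnB.
move=> /nbhs_ballP[e /= e0 eB]; have eE := ge0_ReC (ltW e0).
have [|t Et ts] := Es (complex.Re e); first by rewrite -ltcR -eE.
exists t; split=> //; apply: eB; rewrite -ball_normE/= rnE eE ltcR rnB//.
Qed.

Hypothesis Acpt : compact_op A.
Variable U : set_system nat.
Hypothesis UU : UltraFilter U.
Let UP : ProperFilter U. Proof. exact: ultra_proper. Qed.
Existing Instance UP.

(** The images of a bounded sequence have a limit along [U] by compactness, and
    it can only be the weak one. *)
Lemma compact_weak_cvg x l : (forall k, rn (x k) <= 1) -> weak_cvg U x l ->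
  (A \o x) @ U --> A l.
Proof.
move=> x1 xl; have := Acpt; rewrite /compact_op precompactE compact_ultra/=.
move=> /(_ _ (ultra_fmap (A \o x) UU)) [|z [_ xz]].
  change (U ((A \o x) @^-1` closure (A @` [set y | `|y| <= 1]))).
  apply: filterE => k /=; apply: subset_closure; exists (x k) => //=.
  by rewrite rnE lecR.
suff -> : A l = z by exact: xz.
have [_ AP] := adjointP bP Ac.
apply: hdot_ext => y.
apply: (@limn_unique _ R[i]^o _ U _ (fun k => hdot (A (x k)) y)).
  rewrite AP; under eq_fun do rewrite AP; exact: xl.
exact: (cvg_hdotl (f := A \o x) xz).
Qed.

(** Each term converges because one factor converges in norm and the other
    weakly; the series are dominated by a multiple of [`|c n|]. *)
Lemma values_weak_cvg (x : nat -> nat -> H) (l : nat -> H) (s : nat -> R[i]) t :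
  (forall k n, rn (x k n) <= 1) -> (forall n, weak_cvg U (x^~ n) (l n)) ->
  (forall k, has_sum (fun n => (c n)%:C * hdot (A (x k n)) (x k n)) (s k)) ->
  has_sum (fun n => (c n)%:C * hdot (A (l n)) (l n)) t ->
  (s : nat -> R[i]^o) @ U --> (t : R[i]^o).
Proof.
move=> x1 xl xs lt; have [M M0 AM] := (continuous_boundedP A).1 Ac.
have bd y n : rn y <= 1 -> rn ((c n)%:C * hdot (A y) y) <= `|c n| * M.
  move=> y1; rewrite rnM rn_real ler_wpM2l// (le_trans (cauchy_schwarz _ _))//.
  rewrite -[leRHS]mulr1 ler_pM ?rn_ge0// (le_trans (AM _))//.
  by rewrite -[leRHS]mulr1 ler_wpM2l.
apply: (tannery (u := fun n k => (c n)%:C * hdot (A (x k n)) (x k n))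
  (g := fun n => `|c n| * M) (S := S * M)) xs lt => [n k|n|N|n].
- exact: bd.
- apply: bd; exact: (weak_cvg_le UU (x := x^~ n) (x1^~ n) (xl n)).
- by rewrite -mulr_suml ler_wpM2r.
have Axl := compact_weak_cvg (fun k => x1 k n) (xl n).
apply: (@cvgZl_tmp _ R[i]^o _ _ _ (c n)%:C).
have -> : (fun k => hdot (A (x k n)) (x k n) : R[i]^o) =
    (fun k => (hdot (A (x k n)) (x k n) - hdot (A (l n)) (x k n)) + hdot (A (l n)) (x k n)).
  by apply/funext => k; rewrite subrK.
rewrite -[hdot _ _]add0r; apply: (@cvgD _ R[i]^o).
  apply: (cvg_rn_bound (V := H) (W := R[i]^o) (M := 1)) Axl => k.
  rewrite subr0 mul1r -hdotBl (le_trans (cauchy_schwarz _ _))//.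
  by rewrite ler_piMr ?rn_ge0.
apply: (cvg_rn_bound (V := R[i]^o) (W := R[i]^o) (M := 1)) (xl n (A (l n))) => k.
by rewrite mul1r hdotC [hdot (A _) (l n)]hdotC -conjcN -conjcD rnJ.
Qed.

Hypothesis Uoo : \oo `<=` U.

(** Approximating contractive families have a termwise weak limit along [U]; it is
    contractive, and its value is the limit of the values. *)
Lemma contractive_values_closed : closure contractive_values `<=` contractive_values.
Proof.
move=> t /closure_rnP tE.
have /choice[s sP] k : exists s : R[i], contractive_values s /\ rn (s - t : R[i]) < k.+1%:R^-1.
  have [|s Es st] := tE k.+1%:R^-1; first by rewrite invr_gt0.
  by exists s.
have /choice[x xP] k : exists f : nat -> H, contractive f /\
    has_sum (fun n => (c n)%:C * hdot (A (f n)) (f n)) (s k).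
  by have [[f cf fs] _] := sP k; exists f.
have x1 k n : rn (x k n) <= 1 by apply: contractive_le1; have [] := xP k.
have /choice[l lP] n : exists l, weak_cvg U (x^~ n) l.
  exact: (weak_compactness UU bP (x := x^~ n) (x1^~ n)).
exists l.
  move=> N a; set Q := \sum_(n < N) rn (a n) ^+ 2.
  have Q0 : 0 <= Q by apply: sumr_ge0 => n _; rewrite sqr_ge0.
  (* bounds on the norm pass to weak limits *)
  suff h : rn (\sum_(n < N) a n *: l n) <= Num.sqrt Q.
    by rewrite -[leRHS](sqr_sqrtr Q0) ler_pXn2r// nnegrE ?rn_ge0 ?sqrtr_ge0.
  apply: (weak_cvg_le UU) (weak_cvg_comb UU (N := N) (a := a) (x := fun n k => x k n) lP) => k.
  rewrite -[leLHS]ger0_norm ?rn_ge0// -sqrtr_sqr ler_wsqrtr//.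
  by have [+ _] := xP k; apply.
have [r lr] := contractive_value_exists (fun n => weak_cvg_le UU (x := x^~ n) (x1^~ n) (lP n)).
suff -> : t = r by [].
have sr := values_weak_cvg x1 lP (fun k => (xP k).2) lr.
apply: (@limn_unique _ R[i]^o _ U _ s) sr.
apply/cvg_rnP => e e0.
have : U [set k | k.+1%:R^-1 < e].
  apply: Uoo; have := @cvg_harmonic R => /cvgrPdist_lt/(_ _ e0).
  by apply: filterS => k; rewrite sub0r normrN /harmonic/= ger0_norm ?invr_ge0.
apply: filterS => k /= ke; apply: lt_trans ke.
by have [] := sP k.
Qed.

End Values.

(** * The numerical range of the closed orbit *)

Section OrbitRange.
Context {R : realType} {H : hilbertType R}.
Hypothesis bP : orthonormal_basis (@onb R H).
Variables (C A : {linear H -> H}) (c : nat -> R) (e : nat -> H) (S : R).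
Hypothesis Cc : continuous C.
Hypothesis Ac : continuous A.
Hypothesis Cd : diagonal_op C c e.
Hypothesis ce : contractive e.
Hypothesis cS : forall N, \sum_(n < N) `|c n| <= S.

Let e1 n : rn (e n) <= 1. Proof. exact: contractive_le1. Qed.

Lemma orbit_range_diagonal (h : nat -> H) s :
  (forall n m, hdot (h n) (h m) = hdot (e n) (e m)) ->
  has_sum (fun n => (c n)%:C * hdot (A (h n)) (h n)) s -> orbit_range C A s.
Proof.
move=> he hs.
have h1 n : rn (h n) <= 1.
  rewrite -(expr_le1 (n := 2)) ?rn_ge0// -Re_hdot he Re_hdot.
  by rewrite expr_le1// rn_ge0.
have [X Xc Xd] := diagonal_exists bP cS h1.
exists X; first exact: (orbit_closure_diagonal bP Cc cS e1 Cd) Xc Xd he.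
have [M M0 AM] := (continuous_boundedP A).1 Ac.
have [t [ht htr _]] := trace_formula bP Xd h1 h1 cS Ac AM M0.
by rewrite (trace_has_sum (T := X \o A) htr); exact: has_sum_unique ht hs.
Qed.

Lemma orbit_range_unitary U V s : unitary_pair U V ->
  has_sum (fun n => (c n)%:C * hdot (A (U (e n))) (U (e n))) s -> orbit_range C A s.
Proof.
move=> UV; apply: (orbit_range_diagonal (h := U \o e)) => n m.
exact: unitary_pair_dot UV.
Qed.

(** Up to a small error in the trace, elements of the closed orbit are
    [U C U^*], and the families [U (e n)] are contractive. *)
Lemma orbit_range_closure_values : orbit_range C A `<=` closure (contractive_values A c).
Proof.
move=> _ [X Xorb <-]; apply/closure_rnP => eps eps0.
have [U [V [s [UV hs Xs]]]] := orbit_closure_trace bP Cc cS e1 Cd Xorb Ac eps0.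
exists s; last by rewrite rnB.
exists (U \o e) => // N a; apply: le_trans (ce N a).
rewrite (_ : \sum_(n < N) _ = U (\sum_(n < N) a n *: e n)).
  by rewrite (unitary_pair_rn _ UV).
by rewrite linear_sum; apply: eq_bigr => n _; rewrite linearZ.
Qed.

End OrbitRange.

Section EigenRange.
Context {R : realType} {H : hilbertType R}.
Local Notation b := (@onb R H).
Hypothesis bP : orthonormal_basis b.
Variables (C A : {linear H -> H}) (c : nat -> R) (e : nat -> H) (S : R).
Hypothesis Cc : continuous C.
Hypothesis Ac : continuous A.
Hypothesis Ce : eigensystem C c e.
Hypothesis cS : forall N, \sum_(n < N) `|c n| <= S.

Lemma eigen_diagonal : diagonal_op C c e.
Proof. by move=> x y; apply: (eigen_expansion Ce cS) => // n; case: Ce. Qed.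

Lemma eigen_gram m n : hdot (e m) (e n) = if c n == 0 then 0 else (m == n)%:R.
Proof.
have [eo _ e0 en1 _] := Ce; have [/e0 ->|cn] := eqVneq (c n) 0; first by rewrite hdot0r.
have [->|mn] := eqVneq m n; last by rewrite eo.
by rewrite hdotE en1// expr1n.
Qed.

(** In infinite dimension a contractive family is a weak limit of systems
    [U_m (e n) = f n + g n] with [g n] orthogonal to the first [m] vectors of the
    basis. *)
Lemma values_sub_closure : compact_op A -> hdim [set: H] = +oo%E ->
  contractive_values A c `<=` closure (orbit_range C A).
Proof.
move=> Acpt Hoo t /contractive_values_restrict[f [cf f0 ft]].
have [Uf [UU Uoo]] := free_ultrafilter.
have UP : ProperFilter Uf by exact: ultra_proper.
have step m : exists p : {linear H -> H} * {linear H -> H}, unitary_pair p.1 p.2 /\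
    forall n j, (n < m)%N -> (j < m)%N -> hdot (p.1 (e n)) (b j) = hdot (f n) (b j).
  pose E := [seq f k | k <- iota 0 m] ++ [seq b k | k <- iota 0 m].
  have [|||g [Vg g0 gf]] := @dilation _ H H f (fun n => c n != 0)
      [set x | forall z, z \in E -> hdot x z = 0] cf (eigen_initial Ce).
  - by move=> a x y Vx Vy z zE; rewrite hdotDl hdotZl Vx// Vy// mulr0 addr0.
  - by move=> z _; rewrite hdot0l.
  - move=> n _ s sn.
    have [k nk Hk] : exists2 k, (size (s ++ E) < k)%N & independent_in [set: H] k.
      by apply: (@independent_in_hdim _ _ [set: H] (size (s ++ E)).+1); rewrite Hoo leey.
    have [||u [_ u1 uz]] := unit_orthogonal (V := [set: H]) _ _ Hk nk => //.
    exists u; split=> // z zz; apply: uz; rewrite mem_cat ?zz ?orbT//.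
  have fE k : (k < m)%N -> f k \in E.
    by move=> km; rewrite mem_cat map_f// mem_iota.
  have bE k : (k < m)%N -> b k \in E.
    by move=> km; rewrite mem_cat orbC map_f// mem_iota.
  have [|U [V [UV Ue]]] := @unitary_extension _ _ m e (fun n => f n + g n).
    move=> i j im jm; rewrite eigen_gram hdotDl !hdotDr.
    rewrite (hdotC (g j) (f i)) (Vg j _ (fE _ im)) (Vg i _ (fE _ jm)) conjc0 addr0 add0r.
    have [cj|cj] := eqVneq (c j) 0; first by rewrite (g0 j) ?cj ?eqxx// (f0 j cj) !hdot0r addr0.
    have [ci|ci] := eqVneq (c i) 0; last by rewrite gf// addrC subrK.
    rewrite (g0 i) ?ci ?eqxx// (f0 i ci) !hdot0l addr0.
    by case: (eqVneq i j) ci cj => // ->->; rewrite eqxx.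
  exists (U, V); split=> //= n j nm jm.
  by rewrite Ue// hdotDl (Vg n _ (bE _ jm)) addr0.
have /choice[p pP] := step.
have x1 k n : rn ((p k).1 (e n)) <= 1.
  by have [UV _] := pP k; rewrite (unitary_pair_rn _ UV) (eigen_le1 Ce).
have xf n : weak_cvg Uf (fun k => (p k).1 (e n)) (f n).
  have [l xl] := weak_compactness UU bP (x := fun k => (p k).1 (e n)) (x1^~ n).
  suff -> : f n = l by [].
  apply/eqP; rewrite -subr_eq0; apply/eqP; have [_ _] := bP; apply => j.
  rewrite hdotBl; apply/eqP; rewrite subr_eq0; apply/eqP.
  apply: (@limn_unique _ R[i]^o _ Uf _ (fun k => hdot ((p k).1 (e n)) (b j))) (xl (b j)).
  apply/cvg_rnP => eps eps0; have : Uf [set k | (maxn n j < k)%N].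
    by apply: Uoo; exists (maxn n j).+1.
  apply: filterS => k /=; rewrite gtn_max => /andP[nk jk].
  by have [_ ->//] := pP k; rewrite subrr rn0.
have /choice[s sP] k := contractive_value_exists Ac cS (fun n => x1 k n).
have st := values_weak_cvg bP Ac cS Acpt UU x1 xf sP ft.
apply/closure_rnP => eps eps0.
have /cvg_rnP/(_ _ eps0) := st => /filter_ex[k ks].
exists (s k) => //; have [UV _] := pP k.
exact: (orbit_range_unitary bP Cc Ac eigen_diagonal (eigen_contractive Ce) cS) UV (sP k).
Qed.

(** The first [n.+1] eigenvectors are independent and lie in the range. *)
Lemma eigen_rank n : c n != 0 -> (n.+1%:R%:E <= rank C)%E.
Proof.
move=> cn; apply: hdim_ge.
have ci (i : 'I_n.+1) : c i != 0 by apply: (eigen_initial Ce) cn; rewrite -ltnS.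
exists (fun i : 'I_n.+1 => e i); split=> [i|a a0 i].
  have [_ Cen _ _ _] := Ce; exists ((c i)^-1%:C *: e i) => //.
  by rewrite linearZ/= Cen scalerA -realcM mulVf// scale1r.
have := congr1 (fun x => hdot x (e i)) a0; rewrite hdot0l hdot_suml (bigD1 i)//=.
rewrite big1 ?addr0 => [|j ji]; rewrite hdotZl eigen_gram (negbTE (ci i)).
  by rewrite eqxx mulr1.
by rewrite [_ == _](negbTE ji) mulr0.
Qed.

End EigenRange.

(** * Spectral decomposition of the given operator *)

Section TraceClassSelfadjoint.
Context {R : realType} {H : hilbertType R}.
Local Notation b := (@onb R H).
Hypothesis bP : orthonormal_basis b.
Variable C : {linear H -> H}.
Hypothesis Cc : continuous C.
Hypothesis Cs : selfadjoint C.

(** If [C x = c x] then [(|C| + |c|) (|C| x - |c| x) = C (C x) - c ^ 2 x = 0],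
    and [|C| + |c|] is injective for nonzero [c]. *)
Lemma opabs_eigenvector (c : R) x : c != 0 -> C x = c%:C *: x ->
  opabs C x = `|c|%:C *: x.
Proof.
move=> c0 Cx; have [Pc Pp PP] := opabsP bP Cc; have [_ CP] := adjointP bP Cc.
have PPx : opabs C (opabs C x) = (`|c| ^+ 2)%:C *: x.
  rewrite -/((opabs C \o opabs C) x) PP/=; apply: hdot_ext => y.
  rewrite hdotC -CP -hdotC -Cs Cx linearZ/= Cx scalerA -realcM -expr2.
  by rewrite real_normK ?num_real.
set z := opabs C x - `|c|%:C *: x.
have Pz : opabs C z = - `|c|%:C *: z.
  rewrite /z linearB linearZ/= PPx scalerBr scalerA scaleNr mulNr -realcM -expr2.
  by rewrite scaleNr opprK addrC.
have := Pp z; rewrite Pz hdotZl hdotE -realcN -realcM ler0c mulNr oppr_ge0.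
rewrite pmulr_rle0 ?normr_gt0// => z0; apply/eqP; rewrite -subr_eq0; apply/eqP/rn0_eq0.
by apply/eqP; rewrite -sqrf_eq0 eq_le z0 sqr_ge0.
Qed.

Lemma selfadjoint_trace_class_eigensystem : trace_class C ->
  exists (c : nat -> R) (e : nat -> H) (S : R),
    eigensystem C c e /\ forall N, \sum_(n < N) `|c n| <= S.
Proof.
move=> /trace_class_bound[S CS]; have [Pc Pp _] := opabsP bP Cc.
have [S' CS'] := trace_norm_hilbert_schmidt bP Cc CS.
have [U [UU Uoo]] := free_ultrafilter.
have [c [e Ce]] := hilbert_schmidt_eigensystem UU bP Uoo Cc Cs CS'.
exists c, e, S; split=> // N; have [eo Cen e0 e1 _] := Ce.
apply: (eigenvalues_le_trace bP (Q := opabs C) (p := fun n => `|c n|) (e := e)) => // [n|n|].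
- have [cn|cn] := eqVneq (c n) 0; last exact: opabs_eigenvector.
  by rewrite e0// linear0 scaler0.
- by rewrite normr_eq0; exact: e1.
- exact/trace_norm_leP.
Qed.

End TraceClassSelfadjoint.

(** * Direct sums *)

Section DirectSum.
Context {R : realType} (H K : hilbertType R).
Implicit Types (x y : hsum H K).

Lemma hsum_hdotE x y : hdot x y = hdot x.1 y.1 + hdot x.2 y.2.
Proof. by []. Qed.

Lemma hsum_rn_sqr x : rn x ^+ 2 = rn x.1 ^+ 2 + rn x.2 ^+ 2.
Proof. by rewrite -!Re_hdot hsum_hdotE cReD. Qed.

Lemma hsum_rn1 x : rn x.1 <= rn x.
Proof. by apply: ler_of_sqr; rewrite ?rn_ge0// hsum_rn_sqr lerDl sqr_ge0. Qed.

Lemma hsum_sum1 N (a : nat -> R[i]) (f : nat -> hsum H K) :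
  (\sum_(n < N) a n *: f n).1 = \sum_(n < N) a n *: (f n).1.
Proof. by elim: N => [|N IH]; rewrite ?big_ord0// !big_ord_recr/= -IH. Qed.

Lemma hsum_contractive1 (f : nat -> hsum H K) : contractive f ->
  contractive (fun n => (f n).1).
Proof.
move=> cf N a; apply: le_trans (cf N a); rewrite -hsum_sum1.
by rewrite ler_pXn2r ?nnegrE ?rn_ge0// hsum_rn1.
Qed.

(** The two bases, interleaved. *)
Lemma hsum_basis (b : nat -> H) (b' : nat -> K) :
  orthonormal_basis b -> orthonormal_basis b' ->
  exists d : nat -> hsum H K, orthonormal_basis d.
Proof.
move=> [bo bn bx] [bo' bn' bx'].
pose d n : hsum H K := if odd n then (0, b' n./2) else (b n./2, 0).
have halfI m n : m != n -> odd m = odd n -> m./2 != n./2.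
  move=> mn omn; apply: contra_neq mn => h.
  by rewrite -(odd_double_half m) -(odd_double_half n) h omn.
have dn x : rn x = 1 -> `|x| = 1 by move=> x1; rewrite rnE x1.
exists d; split.
- move=> m n mn; rewrite hsum_hdotE /d.
  have := halfI m n mn; case: (odd m); case: (odd n) => h /=;
    rewrite ?hdot0l ?hdot0r ?add0r ?addr0//; [exact/bo'/h|exact/bo/h].
- move=> n; rewrite /d; case: ifP => _.
    have [->|b1] := bn' n./2; first by left.
    right; apply: dn; apply/eqP; rewrite -(@eqrXn2 _ 2) ?rn_ge0//.
    by rewrite hsum_rn_sqr/= rn0 /rn b1 expr0n/= add0r.
  have [->|b1] := bn n./2; first by left.
  right; apply: dn; apply/eqP; rewrite -(@eqrXn2 _ 2) ?rn_ge0//.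
  by rewrite hsum_rn_sqr/= rn0 /rn b1 expr0n/= addr0.
- move=> [x1 x2] xd; congr (_, _).
    apply: bx => n; have := xd n.*2.
    by rewrite hsum_hdotE /d odd_double doubleK/= hdot0r addr0.
  apply: bx' => n; have := xd n.*2.+1.
  by rewrite hsum_hdotE /d /= odd_double uphalf_double/= hdot0r add0r.
Qed.

Lemma opsum0_continuous (T : {linear H -> H}) : continuous T ->
  continuous (opsum T (\0 : {linear K -> K})).
Proof.
move=> /continuous_boundedP[M M0 TM]; apply/continuous_boundedP; exists M => // x.
apply: ler_of_sqr; first by rewrite mulr_ge0// rn_ge0.
rewrite hsum_rn_sqr/= rn0 expr0n addr0 ler_pXn2r ?nnegrE ?mulr_ge0 ?rn_ge0//.
by rewrite (le_trans (TM _))// ler_wpM2l// hsum_rn1.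
Qed.

End DirectSum.

Lemma has_onb (R : realType) (H : hilbertType R) :
  (exists b : nat -> H, orthonormal_basis b) -> orthonormal_basis (@onb R H).
Proof. by move=> [b bP]; exact: xgetPex (ex_intro _ b bP). Qed.

Theorem corollary5p4 (R : realType) (H : hilbertType R)
    (C A : {linear H -> H}) :
  separable H -> hdim [set: H] = +oo%E ->
  continuous C -> selfadjoint C -> trace_class C ->
  continuous A -> compact_op A ->
  (forall H2 : hilbertType R, separable H2 ->
     (rank C <= hdim [set: H2])%E ->
     closure (orbit_range C A) =
     orbit_range (opsum C (\0 : {linear H2 -> H2}))
                 (opsum A (\0 : {linear H2 -> H2}))) /\
  (forall P : {linear H -> H}, projection P -> (rank C <= rank P)%E ->
     P \o A =1 \0 -> A \o P =1 \0 -> closed (orbit_range C A)).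
Proof.
move=> Hsep Hoo Cc Cs Ctc Ac Acpt.
have bP : orthonormal_basis (@onb R H) by apply: has_onb; exact: separable_basis.
have [c [e [S [Ce cS]]]] := selfadjoint_trace_class_eigensystem bP Cc Cs Ctc.
have Cd := eigen_diagonal Ce cS; have ce := eigen_contractive Ce.
have [U [UU Uoo]] := free_ultrafilter.
have Vclosed := contractive_values_closed bP Ac cS Acpt UU Uoo.
have WV : closure (orbit_range C A) `<=` contractive_values A c.
  move=> s sW; apply: Vclosed; rewrite ((closure_id _).1 (closed_closure (A := contractive_values A c))).
  by apply: closure_subset sW; exact: (orbit_range_closure_values bP Cc Ac Cd ce cS).
have [_ _ e0 e1 _] := Ce.
(* enough dimension for the dilation: [c n != 0] makes the rank at least
   [n.+1] *)
have room (K : hilbertType R) (V : set K) : (rank C <= hdim V)%E ->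
    (forall a x y, V x -> V y -> V (a *: x + y)) -> V 0 ->
    forall n, c n != 0 -> forall s : seq K, size s = n ->
      exists u, [/\ V u, rn u = 1 & forall z, z \in s -> hdot u z = 0].
  move=> CV Vl V0 n cn s sn.
  have [m nm Vm] := independent_in_hdim (le_trans (eigen_rank Ce cn) CV).
  by apply: unit_orthogonal Vl V0 Vm _; rewrite sn.
split=> [H2 H2sep CH2|P [Pc Ps PP] CP PA AP].
- have b2P : orthonormal_basis (@onb R H2) by apply: has_onb; exact: separable_basis.
  have bbP : orthonormal_basis (@onb R (hsum H H2)).
    by apply: has_onb; exact: hsum_basis bP b2P.
  set C0 := opsum C _; set A0 := opsum A _.
  pose ee n : hsum H H2 := (e n, 0).
  have C0c : continuous C0 by exact: opsum0_continuous.
  have A0c : continuous A0 by exact: opsum0_continuous.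
  have C0d : diagonal_op C0 c ee.
    move=> x y; rewrite hsum_hdotE /= hdot0l addr0.
    apply: has_sum_ext (Cd x.1 y.1) => n.
    by rewrite !hsum_hdotE/= hdot0l hdot0r !addr0.
  have cee : contractive ee.
    move=> N a; apply: le_trans (ce N a); rewrite hsum_rn_sqr hsum_sum1/=.
    have -> : (\sum_(n < N) a n *: ee n).2 = 0.
      by elim: N => [|N IH]; rewrite ?big_ord0// big_ord_recr/= IH scaler0 addr0.
    by rewrite rn0 expr0n addr0.
  apply/seteqP; split=> s.
    move=> /WV/contractive_values_restrict[f [cf f0 fs]].
    have [|||g [_ g0 gf]] := dilation (D := fun n => c n != 0) (V := [set: H2]) cf (eigen_initial Ce).
    + by [].
    + by [].
    + exact: room.
    (* [f n + g n] has the Gram matrix of [e], and [A (+) 0] only sees [f n] *)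
    pose h n : hsum H H2 := (f n, g n).
    apply: (orbit_range_diagonal bbP C0c A0c C0d cee cS (h := h)).
      move=> m n; rewrite !hsum_hdotE/= hdot0r addr0 (eigen_gram Ce).
      have [cn|cn] := eqVneq (c n) 0; first by rewrite (f0 n cn) (g0 n) ?cn ?eqxx// !hdot0r addr0.
      have [cm|cm] := eqVneq (c m) 0; last by rewrite gf// addrC subrK.
      rewrite (f0 m cm) (g0 m) ?cm ?eqxx// !hdot0l addr0.
      by case: (eqVneq m n) cm cn => // ->->; rewrite eqxx.
    by apply: has_sum_ext fs => n; rewrite hsum_hdotE/= hdot0l addr0.
  move=> sW; apply: (values_sub_closure bP Cc Ac Ce cS Acpt Hoo); apply: Vclosed.
  have := orbit_range_closure_values bbP C0c A0c C0d cee cS sW.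
  apply: closure_subset => t [f cf ft]; exists (fun n => (f n).1).
    exact: hsum_contractive1.
  by apply: has_sum_ext ft => n; rewrite hsum_hdotE/= hdot0l addr0.
- apply/closure_id/seteqP; split; first exact: subset_closure.
  move=> s /WV/contractive_values_restrict[f0 [cf0 f00 fs]].
  (* as [PA = AP = 0], replacing [f0] by [(1 - P) f0] changes no value, and the
     dilation can take place in the range of [P] *)
  have [f fE] : exists f : nat -> H, forall n, f n = f0 n - P (f0 n).
    by exists (fun n => f0 n - P (f0 n)).
  have cf : contractive f.
    move=> N a; apply: le_trans (cf0 N a); set y := \sum_(n < N) a n *: f0 n.
    have -> : \sum_(n < N) a n *: f n = y - P y.
      rewrite /y linear_sum -sumrB; apply: eq_bigr => n _.
      by rewrite fE linearZ/= -scalerBr.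
    have yP : hdot (y - P y) (P y) = 0.
      by rewrite -Ps linearB/= -[P (P y)]/((P \o P) y) PP subrr hdot0l.
    rewrite -[in leRHS](subrK (P y) y) (pythagoras yP) lerDl sqr_ge0//.
  have f0' n : c n = 0 -> f n = 0 by move=> cn; rewrite fE f00// linear0 subrr.
  have [|||g [Vg g0 gf]] := dilation (D := fun n => c n != 0) (V := range P) cf (eigen_initial Ce).
  + move=> a _ _ [x _ <-] [y _ <-]; exists (a *: x + y) => //.
    by rewrite linearP.
  + by exists 0 => //; rewrite linear0.
  + apply: room => //.
      move=> a _ _ [x _ <-] [y _ <-]; exists (a *: x + y) => //.
      by rewrite linearP.
    by exists 0 => //; rewrite linear0.
  have fg m n : hdot (f m) (g n) = 0.
    have [x _ <-] := Vg n.
    by rewrite -Ps fE linearB/= -[P (P _)]/((P \o P) _) PP subrr hdot0l.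
  apply: (orbit_range_diagonal bP Cc Ac Cd ce cS (h := fun n => f n + g n)).
    move=> m n; rewrite hdotDl !hdotDr fg [hdot (g m) (f n)]hdotC fg conjc0.
    rewrite addr0 add0r (eigen_gram Ce).
    have [cn|cn] := eqVneq (c n) 0; first by rewrite (f0' n cn) (g0 n) ?cn ?eqxx// !hdot0r addr0.
    have [cm|cm] := eqVneq (c m) 0; last by rewrite gf// addrC subrK.
    rewrite (f0' m cm) (g0 m) ?cm ?eqxx// !hdot0l addr0.
    by case: (eqVneq m n) cm cn => // ->->; rewrite eqxx.
  apply: has_sum_ext fs => n; congr (_ * _).
  have [x _ gx] := Vg n.
  have APx y : A (P y) = 0 by exact: AP.
  have AfE : A (f n + g n) = A (f0 n).
    by rewrite fE -gx !linearD linearN/= !APx oppr0 !addr0.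
  have PAx y : P (A y) = 0 by exact: PA.
  rewrite AfE fE -gx !hdotDr hdotNr -!Ps PAx !hdot0l oppr0 !addr0//.
Qed.
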